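(* Let $\alpha\in\mathbb R$. There is an infinite sequence of real numbers $\lambda$ for which Mathieu's equation $y''+(\lambda+\alpha\cos2x)y=0$ has a non-trivial real $2\pi$-periodic solution. Let $A$ be such a non-trivial real $2\pi$-periodic solution (for one such $\lambda$), and let $$W(x,y)=\frac{A(x)A'(y)-A'(x)A(y)}{\sin(x-y)},$$ which extends to a continuously differentiable function on $\mathbb R^2$, $2\pi$-periodic in each variable. Then: (i) $W$ defines a self-adjoint Hilbert–Schmidt integral operator on $L^2[0,2\pi]$; (ii) if $\nu\neq0$ is a simple eigenvalue of this operator, then any corresponding eigenfunction $f$ (extended $2\pi$-periodically) is twice continuously differentiable and is a $2\pi$-periodic solution of $f''+(\mu+\alpha\cos2x)f=0$ for some constant $\mu$. *)

(* Defs.v *)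
From HB Require Import structures.
From mathcomp Require Import all_boot all_order all_algebra.
From mathcomp Require Import all_classical all_reals all_analysis.
Set Implicit Arguments. Unset Strict Implicit. Unset Printing Implicit Defensive.
Import Order.TTheory GRing.Theory Num.Theory.
Import numFieldNormedType.Exports.
Local Open Scope classical_set_scope.
Local Open Scope ring_scope.

Section Defs.
Variable R : realType.
Local Notation mu := (@lebesgue_measure R).

Definition I02 : set R := `[0, 2 * pi]%classic.

Definition periodic2pi (f : R -> R) : Prop := forall x, f (x + 2 * pi) = f x.

Definition mathieu_sol (alpha lam : R) (y : R -> R) : Prop :=
  (forall x, derivable y x 1) /\ (forall x, derivable (derive1 y) x 1) /\
  (forall x, derive1 (derive1 y) x + (lam + alpha * cos (2 * x)) * y x = 0).

Definition C2 (f : R -> R) : Prop :=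
  (forall x, derivable f x 1) /\ (forall x, derivable (derive1 f) x 1) /\
  continuous (derive1 (derive1 f)).

Definition C1_2 (W : R -> R -> R) : Prop :=
  (forall x y, derivable (fun t => W t y) x 1 /\ derivable (fun t => W x t) y 1) /\
  continuous (fun z : R * R => W z.1 z.2) /\
  continuous (fun z : R * R => derive1 (fun t => W t z.2) z.1) /\
  continuous (fun z : R * R => derive1 (fun t => W z.1 t) z.2).

Definition sq_int (f : R -> R) : Prop :=
  measurable_fun I02 f /\ mu.-integrable I02 (fun x => ((f x) ^+ 2)%:E).

Definition intop (W : R -> R -> R) (f : R -> R) (x : R) : R :=
  Rintegral mu I02 (fun y => W x y * f y).

Definition hilbert_schmidt_kernel (W : R -> R -> R) : Prop :=
  measurable_fun (I02 `*` I02) (fun z : R * R => W z.1 z.2) /\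
  (mu \x mu)%E.-integrable (I02 `*` I02) (fun z : R * R => ((W z.1 z.2) ^+ 2)%:E) /\
  (forall f, sq_int f -> sq_int (intop W f)).

Definition self_adjoint_kernel (W : R -> R -> R) : Prop :=
  forall f g, sq_int f -> sq_int g ->
    (\int[mu]_(x in I02) ((intop W f x) * g x)%:E =
     \int[mu]_(x in I02) (f x * intop W g x)%:E)%E.

Definition eigenfun (W : R -> R -> R) (nu : R) (f : R -> R) : Prop :=
  sq_int f /\ ~ {ae mu, forall x, I02 x -> f x = 0} /\
  {ae mu, forall x, I02 x -> intop W f x = nu * f x}.

Definition simple_eigenvalue (W : R -> R -> R) (nu : R) : Prop :=
  (exists f, eigenfun W nu f) /\
  (forall f g, eigenfun W nu f -> eigenfun W nu g ->
     exists c : R, {ae mu, forall x, I02 x -> g x = c * f x}).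

End Defs.

(* Main.v *)
Require Import Defs.
From HB Require Import structures.
From mathcomp Require Import all_boot all_order all_algebra.
From mathcomp Require Import all_classical all_reals all_analysis.
From mathcomp Require Import measurable_realfun ring lra.
Import Order.TTheory GRing.Theory Num.Theory.
Import numFieldNormedType.Exports.
Local Open Scope classical_set_scope.
Local Open Scope ring_scope.
Set Implicit Arguments. Unset Strict Implicit.

(** Infinitely many eigenvalues come from shooting: the solution with
    [y 0 = 0], [y' 0 = 1] is odd, and it is [2 pi]-periodic as soon as
    [y pi = 0], since the potential is even about both [0] and [pi].  For
    [lam = (n + 1/2)^2] a Gronwall estimate shows that [y pi] has the sign
    [(-1)^n] when [n] is large, so the intermediate value theorem gives a zero
    between consecutive such values.

    The shift [A (x + pi)] solves the same equation as [A], and their Wronskian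
    changes sign under a further shift by [pi]; hence it vanishes,
    [A (x + pi) = e * A x], and the numerator of [W] is zero wherever
    [sin (x - y)] is.  Divided differences then show that [W] is [C^1].

    The operator [T] with kernel [W] commutes with
    [L = d^2/dx^2 + alpha cos 2x].  The identity behind it is
    [W_x + W_y = K], [K = - 2 alpha sin (x + y) A(x) A(y)], together with
    [K_x - K_y = alpha (cos 2y - cos 2x) W].  Integrating by parts, the first one
    gives [(T h)' = K h + T h'] for periodic [h]; it bootstraps an eigenfunction
    [g] to [C^2], and with the second one it yields [T (L g) = nu (L g)].
    Simplicity of [nu] makes [L g] a multiple of [g]. *)

(** * Derivatives of pointwise expressions *)

Section PointwiseDerivatives.
Variable R : realType.
Implicit Types (f g : R -> R) (x a b : R).

Lemma is_derive_fD f g x (df dg : R) : is_derive x 1 f df -> is_derive x 1 g dg ->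
  is_derive x 1 (fun t => f t + g t) (df + dg).
Proof. by move=> ? ?; exact: is_deriveD. Qed.

Lemma is_derive_fN f x (df : R) : is_derive x 1 f df ->
  is_derive x 1 (fun t => - f t) (- df).
Proof. by move=> ?; exact: is_deriveN. Qed.

Lemma is_derive_fM f g x (df dg : R) : is_derive x 1 f df -> is_derive x 1 g dg ->
  is_derive x 1 (fun t => f t * g t) (df * g x + f x * dg).
Proof.
move=> df1 dg1; have [d1 d2] := is_deriveM df1 dg1; split => //.
rewrite -[LHS]/('D_1 (f * g) x) d2.
by rewrite /GRing.scale /= addrC mulrC.
Qed.

Lemma is_derive_fcst (c x : R) : is_derive x 1 (fun=> c) 0.
Proof. exact: is_derive_cst. Qed.

Lemma is_derive_fid x : is_derive x 1 (fun t : R => t) 1.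
Proof. exact: is_derive_id. Qed.

Lemma is_derive_fcomp f g x (df dg : R) :
  is_derive (g x) 1 f df -> is_derive x 1 g dg ->
  is_derive x 1 (fun t => f (g t)) (df * dg).
Proof. by move=> ? ?; exact: is_derive1_comp. Qed.

Lemma is_derive_fV f x (df : R) : f x != 0 -> is_derive x 1 f df ->
  is_derive x 1 (fun t => (f t)^-1) (- (df / f x ^+ 2)).
Proof.
move=> f0 [d1 d2]; split; first exact: derivableV.
by rewrite deriveV// d2 /GRing.scale /= mulNr mulrC.
Qed.

Lemma is_derive_fsin f x (df : R) : is_derive x 1 f df ->
  is_derive x 1 (fun t => sin (f t)) (cos (f x) * df).
Proof. by move=> ?; apply: is_derive_fcomp. Qed.

Lemma is_derive_fcos f x (df : R) : is_derive x 1 f df ->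
  is_derive x 1 (fun t => cos (f t)) (- sin (f x) * df).
Proof. by move=> ?; apply: is_derive_fcomp. Qed.

Lemma is_derive_fexp f x (df : R) : is_derive x 1 f df ->
  is_derive x 1 (fun t => expR (f t)) (expR (f x) * df).
Proof. by move=> ?; apply: is_derive_fcomp. Qed.

Lemma is_derive_continuous f x (df : R) : is_derive x 1 f df -> {for x, continuous f}.
Proof. by move=> [d _]; apply: differentiable_continuous; apply/derivable1_diffP. Qed.

Lemma is_derive_derive1 f x (df : R) : is_derive x 1 f df -> derive1 f x = df.
Proof. by move=> d; rewrite derive1E derive_val. Qed.

Lemma derivable_is_derive f x : derivable f x 1 -> is_derive x 1 f (derive1 f x).
Proof. by move=> d; rewrite derive1E; exact: derivableP. Qed.

Lemma is_derive_near_eq f g x (df : R) : (\forall t \near x, f t = g t) ->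
  is_derive x 1 f df -> is_derive x 1 g df.
Proof. by move=> fg d; apply: near_eq_is_derive d. Qed.

Lemma is_derive_ext f g x (df : R) : f =1 g -> is_derive x 1 f df -> is_derive x 1 g df.
Proof. by move=> /funext ->. Qed.

Lemma derive_ge0_le f (df : R -> R) a b : a <= b ->
  (forall x, is_derive x 1 f (df x)) ->
  (forall x, a <= x -> x <= b -> 0 <= df x) -> f a <= f b.
Proof.
move=> ab d p; have [|c cab e] := @MVT_segment R f df a b ab (fun x _ => d x).
  by apply: derivable_within_continuous => x _; exact: ex_derive.
rewrite -subr_ge0 e mulr_ge0 ?subr_ge0//.
by move: cab; rewrite in_itv /= => /andP[? ?]; exact: p.
Qed.

Lemma derive_0_eq f a b : (forall x, is_derive x 1 f 0) -> f a = f b.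
Proof.
suff H : forall a b, a <= b -> (forall x, is_derive x 1 f 0) -> f a = f b.
  by move=> d; have [/H|/ltW/H] := leP a b => // /(_ d).
move=> {}a {}b ab d; apply/le_anti/andP; split.
  exact: (@derive_ge0_le f (fun=> 0)).
rewrite -lerN2.
apply: (@derive_ge0_le (fun x => - f x) (fun=> - 0)) => // x _ _; rewrite oppr0.
Qed.

End PointwiseDerivatives.

(* Plain [apply:] would let instance resolution pick the library's own rules,
   whose values mention scalar multiplication and are out of reach of [ring]. *)
Ltac derive_step :=
  lazymatch goal with |- @is_derive ?R ?V ?W ?x ?v ?f ?d =>
    let f' := eval cbv beta in (fun t => f t) in change (@is_derive R V W x v f' d)
  end;
  first [ exact: is_derive_fcst | exact: is_derive_fid |
  lazymatch goal with
  | |- is_derive _ _ (fun t => (@?f t)^-1) _ =>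
      notypeclasses refine (is_derive_fV _ _)
  | |- is_derive _ _ (fun t => @?f t + @?g t) _ =>
      notypeclasses refine (is_derive_fD _ _)
  | |- is_derive _ _ (fun t => @?f t * @?g t) _ =>
      notypeclasses refine (is_derive_fM _ _)
  | |- is_derive _ _ (fun t => - @?f t) _ => notypeclasses refine (is_derive_fN _)
  | |- is_derive _ _ (fun t => sin (@?f t)) _ => notypeclasses refine (is_derive_fsin _)
  | |- is_derive _ _ (fun t => cos (@?f t)) _ => notypeclasses refine (is_derive_fcos _)
  | |- is_derive _ _ (fun t => expR (@?f t)) _ => notypeclasses refine (is_derive_fexp _)
  | |- is_derive _ _ (fun t => ?f t) _ => solve [eauto 2]
  | |- is_derive _ _ (fun t => ?f (@?g t)) _ =>
      notypeclasses refine (@is_derive_fcomp _ f g _ _ _ _ _); [solve [eauto 2]|]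
  end ].
Ltac derive := notypeclasses refine (is_derive_eq _ _);
  [repeat derive_step|cbv beta].

(** * Linear second-order equations: uniqueness and existence *)

Section Gronwall.
Variable R : realType.
Implicit Types (a b x : R).

(** Integrating factor: the derivative of [- (E x + D / C) * expR (- C * x)] is
    [(C * E x + D - dE x) * expR (- C * x)], which is nonnegative on the interval. The constant [D]
    leaves room for a forcing term. *)
Lemma gronwall (E dE : R -> R) (C D a b : R) : 0 < C -> a <= b ->
  (forall x, is_derive x 1 E (dE x)) ->
  (forall x, a <= x -> x <= b -> dE x <= C * E x + D) ->
  E b + D / C <= (E a + D / C) * expR (C * (b - a)).
Proof.
move=> C0 ab dEx bE.
have : (fun x => - (E x + D / C) * expR (- C * x)) a <=
       (fun x => - (E x + D / C) * expR (- C * x)) b.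
  apply: (@derive_ge0_le _ (fun x => - (E x + D / C) * expR (- C * x))
    (fun x => (C * E x + D - dE x) * expR (- C * x))) => //.
  - move=> x; derive.
    by field; rewrite gt_eqF.
  - by move=> x xa xb; rewrite mulr_ge0 ?expR_ge0 ?subr_ge0 ?bE.
rewrite /= !mulNr lerN2 => h.
have -> : C * (b - a) = - (C * a) - - (C * b) by ring.
by rewrite expRB mulrA ler_pdivlMr ?expR_gt0// .
Qed.

End Gronwall.

(** * Energy estimates and uniqueness for Hill's equation *)

Section HillUniqueness.
Variable R : realType.
Implicit Types (q y dy : R -> R).

(** The equation [y'' + q y = 0] as a first-order system. The derivative is carried as a separate
    function, so that reflections, shifts and differences of solutions are again explicit pairs. *)
Definition hill_sol q y dy :=
  (forall x : R, is_derive x 1 y (dy x)) /\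
  (forall x : R, is_derive x 1 dy (- (q x * y x))).

Lemma hill_sol_reflect q y dy : hill_sol q y dy ->
  hill_sol (fun x => q (- x)) (fun x => y (- x)) (fun x => - dy (- x)).
Proof. by move=> [d1 d2]; split => x; derive; ring. Qed.

Lemma hill_sol_shift q y dy (c : R) : hill_sol q y dy ->
  hill_sol (fun x => q (x + c)) (fun x => y (x + c)) (fun x => dy (x + c)).
Proof. by move=> [d1 d2]; split => x; derive; ring. Qed.

Lemma hill_sol_scale q y dy (c : R) : hill_sol q y dy ->
  hill_sol q (fun x => c * y x) (fun x => c * dy x).
Proof. by move=> [d1 d2]; split => x; derive; ring. Qed.

Lemma hill_solB q y dy z dz : hill_sol q y dy -> hill_sol q z dz ->
  hill_sol q (fun x => y x - z x) (fun x => dy x - dz x).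
Proof. by move=> [d1 d2] [d3 d4]; split => x; derive; ring. Qed.

Lemma hill_sol_eqq p q y dy : p =1 q -> hill_sol p y dy -> hill_sol q y dy.
Proof. by move=> pq [d1 d2]; split => // x; rewrite -pq. Qed.

(** For [z'' + q z = r], the energy [z^2 + z'^2] has derivative at most [(2 + Q)] times itself plus
    [r^2], by three arithmetic-geometric inequalities; Gronwall does the rest. With [S = 0] it gives
    uniqueness and growth bounds, with [S > 0] dependence on the parameter. *)
Lemma hill_forcing_energy (q z dz r : R -> R) (Q S a b : R) : 0 <= Q ->
  (forall x, `|q x| <= Q) ->
  (forall x : R, is_derive x 1 z (dz x)) ->
  (forall x : R, is_derive x 1 dz (r x - q x * z x)) ->
  a <= b -> (forall x, a <= x -> x <= b -> r x ^+ 2 <= S) ->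
  z b ^+ 2 + dz b ^+ 2 + S / (2 + Q) <=
  (z a ^+ 2 + dz a ^+ 2 + S / (2 + Q)) * expR ((2 + Q) * (b - a)).
Proof.
move=> Q0 qQ d1 d2 ab rS; pose E x := z x ^+ 2 + dz x ^+ 2.
pose dE x := 2 * z x * dz x + 2 * dz x * (r x - q x * z x).
apply: (@gronwall _ E dE) => //; first lra.
- by move=> x; rewrite /E /dE; under eq_fun do rewrite !expr2; derive; ring.
- move=> x xa xb; rewrite /E /dE; have := rS x xa xb.
  have := qQ x; rewrite ler_norml => /andP[].
  move: (z x) (dz x) (r x) (q x) => u v w p p1 p2 p3.
  have h1 : 2 * u * v <= u ^+ 2 + v ^+ 2 by have := sqr_ge0 (u - v); lra.
  have h2 : 2 * v * w <= v ^+ 2 + w ^+ 2 by have := sqr_ge0 (v - w); lra.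
  have h3 : - (2 * p * u * v) <= Q * (u ^+ 2 + v ^+ 2).
    have h4 : 0 <= (Q - p) * (u - v) ^+ 2 by rewrite mulr_ge0 ?sqr_ge0//; lra.
    have h5 : 0 <= (Q + p) * (u + v) ^+ 2 by rewrite mulr_ge0 ?sqr_ge0//; lra.
    lra.
  have := sqr_ge0 u; lra.
Qed.

Lemma hill_unique0 q y dy (Q a : R) : (forall x, `|q x| <= Q) ->
  hill_sol q y dy -> y a = 0 -> dy a = 0 -> forall x, y x = 0.
Proof.
move=> qQ; have Q0 : 0 <= Q by apply: le_trans (qQ 0).
(* The energy estimate runs to the right only; points left of [a] are reached by reflecting the
   equation. *)
suff fwd q' z dz c : (forall x, `|q' x| <= Q) -> hill_sol q' z dz ->
    z c = 0 -> dz c = 0 -> forall x, c <= x -> z x = 0.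
  move=> s ya dya x; have [/(fwd _ _ _ _ qQ s ya dya) //|xa] := leP a x.
  rewrite -[x]opprK.
  by apply: (fwd _ _ _ (- a) _ (hill_sol_reflect s)) => //=;
    rewrite ?opprK ?dya ?oppr0// lerN2 ltW.
move=> q'Q [d1 d2] z0 dz0 x cx.
have d3 (t : R) : is_derive t 1 dz (0 - q' t * z t) by rewrite sub0r.
have := hill_forcing_energy Q0 q'Q d1 d3 cx (S := 0).
rewrite z0 dz0 mul0r !expr0n /= !addr0 mul0r => /(_ (fun _ _ _ => lexx _)) h.
by apply/eqP; rewrite -sqrf_eq0 eq_le sqr_ge0 andbT (le_trans _ h)// lerDl sqr_ge0.
Qed.

Lemma hill_unique q y dy z dz (Q a : R) : (forall x, `|q x| <= Q) ->
  hill_sol q y dy -> hill_sol q z dz -> y a = z a -> dy a = dz a ->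
  forall x, y x = z x.
Proof.
move=> qQ sy sz e de x; apply/subr0_eq.
by apply: (hill_unique0 (a := a) qQ (hill_solB sy sz)) => /=;
  rewrite ?e ?de subrr.
Qed.

End HillUniqueness.

(** * Existence for Hill's equation by weighted Picard iteration *)

Section HillExistence.
Variable R : realType.
Notation mu := (@lebesgue_measure R).

Lemma continuous_itv_integrable (f : R -> R) (a b : R) : continuous f ->
  mu.-integrable `[a, b] (EFin \o f).
Proof.
move=> cf; apply: continuous_compact_integrable; first exact: segment_compact.
exact: continuous_subspaceT.
Qed.

Lemma antiderivative_exists (f : R -> R) : continuous f ->
  exists F : R -> R, F 0 = 0 /\ forall x : R, is_derive x 1 F (f x).
Proof.
move=> cf.
(* For either sign of [x] one of the two intervals is empty or a single point, so [F] is the signed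
   integral from [0] to [x]. *)
pose F (x : R) : R := Rintegral mu `[0, x] f - Rintegral mu `[x, 0] f.
exists F; split; first by rewrite /F subrr.
(* Both [0] and [x] lie strictly inside []- N, N[], so near [x] the function [F] differs by a
   constant from the integral with fixed base point [- N]. *)
move=> x; pose N : R := `|x| + 1.
have Nx : - N < x < N by rewrite -ltr_norml /N ltrDl.
have N0 : 0 < N by rewrite /N ltr_wpDl.
pose G (y : R) : R := Rintegral mu `[- N, y] f.
have FG (y : R) : - N < y -> F y = G y - G 0.
  move=> yN; rewrite /F /G; have [y0|y0] := leP 0 y.
    have -> : Rintegral mu `[- N, y] f - Rintegral mu `[- N, 0] f =
        Rintegral mu `]0, y] f.
      apply: Rintegral_itvB; rewrite ?bnd_simp//; last by rewrite oppr_le0 ltW.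
      exact: continuous_itv_integrable.
    rewrite Rintegral_itv_obnd_cbnd; last first.
      apply: (integrableS _ _ _ (continuous_itv_integrable 0 y cf)) => //.
      by apply: subset_itvr; rewrite bnd_simp.
    have [->|yn0] := eqVneq y 0; first by rewrite set_itv1 Rintegral_set1 subr0.
    rewrite [X in _ - X](_ : _ = 0) ?subr0// set_itv_ge ?Rintegral_set0//.
    by rewrite bnd_simp -ltNge lt_neqAle eq_sym yn0.
  rewrite -[RHS]opprB.
  have -> : Rintegral mu `[- N, 0] f - Rintegral mu `[- N, y] f =
      Rintegral mu `]y, 0] f.
    apply: Rintegral_itvB; rewrite ?bnd_simp ?ltW//.
    exact: continuous_itv_integrable.
  rewrite Rintegral_itv_obnd_cbnd; last first.
    apply: (integrableS _ _ _ (continuous_itv_integrable y 0 cf)) => //.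
    by apply: subset_itvr; rewrite bnd_simp.
  rewrite [X in X - _](_ : _ = 0) ?sub0r// set_itv_ge ?Rintegral_set0//.
  by rewrite bnd_simp -ltNge.
have [xN1 xN2] := andP Nx.
apply: (@is_derive_near_eq _ (fun y => G y - G 0)).
  by near=> y; rewrite FG//; near: y; exact: lt_nbhsr.
have [d1 d2] := continuous_FTC1_closed xN2 (continuous_itv_integrable (- N) N cf) xN1 (cf x).
rewrite -d2 -[X in is_derive _ _ _ X]addr0.
have dG := derivable_is_derive d1.
exact: (is_derive_fD dG (is_derive_fcst (- G 0) x)).
Unshelve. all: by end_near. Qed.

(** Twice the hyperbolic cosine. It serves as a weight on the whole line: it dominates [|x|], and
    [ch (K * x)] is reproduced up to the factor [K ^+ 2] by two differentiations. *)
Definition ch (x : R) := expR x + expR (- x).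

Lemma ch_gt0 x : 0 < ch x.
Proof. by rewrite addr_gt0 ?expR_gt0. Qed.

Lemma norm_le_ch x : `|x| <= ch x.
Proof.
have h1 := expR_ge1Dx x; have h2 := expR_ge1Dx (- x).
have := expR_gt0 x; have := expR_gt0 (- x).
by rewrite /ch ler_norml; lra.
Qed.

(** Comparison with [M / K ^+ 2 * ch (K * x)], whose second derivative is the bound on [f]. The gain
    [1 / K ^+ 2] is what makes the Picard map a contraction. *)
Lemma second_antiderivative_bound (h dh f : R -> R) (M K : R) : 0 < K -> 0 <= M ->
  (forall x : R, is_derive x 1 h (dh x)) -> (forall x : R, is_derive x 1 dh (f x)) ->
  h 0 = 0 -> dh 0 = 0 -> (forall x, `|f x| <= M * ch (K * x)) ->
  forall x, `|h x| <= M / K ^+ 2 * ch (K * x).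
Proof.
move=> K0 M0.
(* An upper bound on the half-line suffices: reflection in [0] covers negative [x], and passing to
   [- h] gives the lower bound. *)
suff one (g dg e : R -> R) : (forall x : R, is_derive x 1 g (dg x)) ->
    (forall x : R, is_derive x 1 dg (e x)) -> g 0 = 0 -> dg 0 = 0 ->
    (forall x, `|e x| <= M * ch (K * x)) ->
    forall x : R, 0 <= x -> g x <= M / K ^+ 2 * ch (K * x).
  have two (g dg e : R -> R) : (forall x : R, is_derive x 1 g (dg x)) ->
      (forall x : R, is_derive x 1 dg (e x)) -> g 0 = 0 -> dg 0 = 0 ->
      (forall x, `|e x| <= M * ch (K * x)) ->
      forall x, g x <= M / K ^+ 2 * ch (K * x).
    move=> d1 d2 g0 dg0 b x; have [x0|x0] := leP 0 x; first exact: one d1 d2 _ _ b _ x0.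
    have := @one (fun t => g (- t)) (fun t => - dg (- t)) (fun t => e (- t)).
    move=> /(_ _ _ _ _ _ (- x)); rewrite opprK /ch mulrN opprK [expR _ + _]addrC.
    apply; rewrite ?oppr0 ?dg0 ?oppr0//; last by rewrite oppr_ge0 ltW.
    - by move=> t; derive; ring.
    - by move=> t; derive; ring.
    - move=> t; rewrite (le_trans (b _))// /ch mulrN opprK [expR _ + _]addrC//.
  move=> d1 d2 h0 dh0 b x; rewrite ler_norml (two _ _ _ d1 d2)// andbT lerNl.
  apply: (two (fun t => - h t) (fun t => - dh t) (fun t => - f t)); rewrite ?h0 ?dh0 ?oppr0//.
  by move=> t; rewrite normrN.
move=> d1 d2 g0 dg0 b x x0.
have Kn0 : K != 0 by rewrite gt_eqF.
(* The derivative of the comparison function minus [g]. It vanishes at [0] and is itself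
   nondecreasing. *)
pose s t := M / K * (expR (K * t) - expR (- (K * t))) - dg t.
have s0 (t : R) : 0 <= t -> 0 <= s t.
  move=> t0; have -> : 0 = s 0 by rewrite /s dg0 mulr0 oppr0; ring.
  apply: (@derive_ge0_le _ s (fun t => M * ch (K * t) - e t)) => //.
    by move=> u; rewrite /s /ch; derive; field.
  by move=> u _ _; rewrite subr_ge0 (le_trans (ler_norm _)).
have : (fun t => M / K ^+ 2 * ch (K * t) - g t) 0 <=
       (fun t => M / K ^+ 2 * ch (K * t) - g t) x.
  apply: (@derive_ge0_le _ (fun t => M / K ^+ 2 * ch (K * t) - g t) s) => //.
    by move=> u; rewrite /s /ch; derive; field.
  by move=> u u0 _; exact: s0.
rewrite /= g0 subr0 -[g x <= _]subr_ge0; apply: le_trans.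
by rewrite mulr_ge0 ?(ltW (ch_gt0 _))// divr_ge0// sqr_ge0.
Qed.

(** The intervals of radius [C / 2 ^+ n] around [u n] are nested, since each step is at most half
    the radius; the limit is the supremum of their left endpoints. *)
Lemma geometric_limit (u : nat -> R) (C : R) :
  (forall n, `|u n.+1 - u n| <= C / 2 ^+ n.+1) ->
  exists l, forall n, `|u n - l| <= C / 2 ^+ n.
Proof.
move=> b; have C0 : 0 <= C.
  have := le_trans (normr_ge0 _) (b 0%N); rewrite expr1; lra.
pose lo n := u n - C / 2 ^+ n; pose hi n := u n + C / 2 ^+ n.
have half n : C / 2 ^+ n = C / 2 ^+ n.+1 + C / 2 ^+ n.+1.
  by rewrite exprS; field; rewrite expf_neq0.
have los m n : (m <= n)%N -> lo m <= lo n.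
  move=> /subnK <-; elim: (n - m)%N => // k /le_trans; apply.
  have := b (k + m)%N; rewrite addSn ler_norml /lo (half (k + m)%N) => /andP[]; lra.
have his m n : (m <= n)%N -> hi n <= hi m.
  move=> /subnK <-; elim: (n - m)%N => // k; apply: le_trans.
  have := b (k + m)%N; rewrite addSn ler_norml /hi (half (k + m)%N) => /andP[]; lra.
have lohi m n : lo m <= hi n.
  apply: (le_trans (los m (maxn m n) (leq_maxl _ _))).
  apply: (le_trans _ (his n (maxn m n) (leq_maxr _ _))).
  rewrite /lo /hi; have : 0 <= C / 2 ^+ maxn m n by rewrite divr_ge0// exprn_ge0.
  lra.
exists (sup (range lo)) => n.
have h1 : lo n <= sup (range lo).
  by apply: ub_le_sup; [exists (hi 0%N) => _ [m _ <-]|exists n].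
have h2 : sup (range lo) <= hi n.
  by apply: ge_sup => [|_ [m _ <-]//]; exists (lo 0%N), 0%N.
by move: h1 h2; rewrite /lo /hi ler_norml; lra.
Qed.

Lemma second_antiderivative_exists (f : R -> R) : continuous f ->
  exists p : (R -> R) * (R -> R), [/\ p.1 0 = 0, p.2 0 = 0,
    forall x : R, is_derive x 1 p.1 (p.2 x) & forall x : R, is_derive x 1 p.2 (f x)].
Proof.
move=> cf; have [g [g0 dg]] := antiderivative_exists cf.
have [|h [h0 dh]] := @antiderivative_exists g.
  by move=> x; exact: is_derive_continuous (dg x).
by exists (h, g).
Qed.

Lemma div_pow2_lt (C e : R) : 0 < e -> exists n, C / 2 ^+ n < e.
Proof.
move=> e0; have [n nC] : exists n : nat, C / e < n%:R.
  by exists (Num.Def.truncn (C / e)).+1; rewrite truncnS_gt.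
exists n; rewrite ltr_pdivrMr ?exprn_gt0// mulrC -ltr_pdivrMr// (lt_trans nC)//.
by rewrite -natrX ltr_nat ltn_expl.
Qed.

(** Three-epsilon argument. The error bound depends on the point, but continuity of [B] keeps it
    below [B x + 1] near [x]. *)
Lemma locally_uniform_limit_continuous (u : nat -> R -> R) (y B : R -> R) :
  (forall n, continuous (u n)) -> continuous B ->
  (forall n x, `|u n x - y x| <= B x / 2 ^+ n) -> continuous y.
Proof.
move=> cu cB b /= x; apply/cvgrPdist_lt => /= e e0.
have B0 t : 0 <= B t by have := le_trans (normr_ge0 _) (b 0%N t); rewrite expr0 divr1.
have [n nB] : exists n, (B x + 1) / 2 ^+ n < e / 3 by apply: div_pow2_lt; lra.
near=> t.
have h1 : `|u n x - u n t| < e / 3.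
  by near: t; move/cvgrPdist_lt : (cu n x); apply; lra.
have h2 : B t < B x + 1.
  have : `|B x - B t| < 1 by near: t; move/cvgrPdist_lt : (cB x); apply.
  by rewrite ltr_norml => /andP[]; lra.
have h3 : `|u n t - y t| < e / 3.
  by rewrite (le_lt_trans (b n t))// (le_lt_trans _ nB)// ler_pM2r ?invr_gt0 ?exprn_gt0// ltW.
have h4 : `|u n x - y x| < e / 3.
  by rewrite (le_lt_trans (b n x))// (le_lt_trans _ nB)// ler_pM2r ?invr_gt0 ?exprn_gt0// lerDl.
have -> : y x - y t = - (u n x - y x) + (u n x - u n t) + (u n t - y t) by ring.
rewrite (le_lt_trans (ler_normD _ _))// [e in _ < e](_ : _ = (e / 3 + e / 3) + e / 3); last lra.
rewrite ltrD// (le_lt_trans (ler_normD _ _))// ltrD// normrN//.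
Unshelve. all: by end_near. Qed.

(** Picard iteration for [y = x - J (q y)], where [J] integrates twice from [0]. In the norm
    weighted by [ch (K * x)] the map contracts by one half on the whole line at once, so no gluing
    of local solutions arises. *)
Lemma hill_exists (q : R -> R) (Q : R) : continuous q -> (forall x, `|q x| <= Q) ->
  exists y dy, [/\ hill_sol q y dy, y 0 = 0 & dy 0 = 1].
Proof.
move=> cq qQ; have Q0 : 0 <= Q by apply: le_trans (qQ 0).
(* Large enough for [Q / K ^+ 2 <= 1 / 2], and at least [1] so that [|x| <= ch (K * x)]. *)
pose K : R := 1 + 2 * Q.
have K1 : 1 <= K by rewrite /K; lra.
have QK : Q / K ^+ 2 <= 1 / 2.
  rewrite ler_pdivrMr ?exprn_gt0//; last lra.
  by rewrite /K; nra.
(* [J f] is the pair of the twofold and the simple antiderivative of [f], both zero at [0]; its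
   value at a discontinuous [f] is arbitrary. *)
have /choice[J HJ] : forall f : R -> R, exists p : (R -> R) * (R -> R),
    continuous f -> [/\ p.1 0 = 0, p.2 0 = 0,
      forall x : R, is_derive x 1 p.1 (p.2 x) & forall x : R, is_derive x 1 p.2 (f x)].
  move=> f; have [cf|ncf] := pselect (continuous f).
    by have [p Hp] := second_antiderivative_exists cf; exists p.
  by exists (f, f).
have cqM (f : R -> R) : continuous f -> continuous (fun x => q x * f x).
  by move=> cf x; apply: cvgM; [exact: cq|exact: cf].
(* The contraction estimate, with factor [Q / K ^+ 2 <= 1 / 2]. *)
have JB (f g : R -> R) (M : R) : continuous f -> continuous g -> 0 <= M ->
    (forall x, `|f x - g x| <= M * ch (K * x)) ->
    forall x, `|(J (fun x => q x * f x)).1 x - (J (fun x => q x * g x)).1 x|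
      <= M / 2 * ch (K * x).
  move=> cf cg M0 b x.
  have [f1 f2 f3 f4] := HJ _ (cqM _ cf); have [g1 g2 g3 g4] := HJ _ (cqM _ cg).
  apply: (@le_trans _ _ (Q * M / K ^+ 2 * ch (K * x))); last first.
    rewrite ler_pM2r ?ch_gt0//.
    have -> : Q * M / K ^+ 2 = M * (Q / K ^+ 2) by ring.
    by rewrite -[2^-1]mul1r ler_wpM2l.
  apply: (@second_antiderivative_bound
      (fun x => (J (fun x => q x * f x)).1 x - (J (fun x => q x * g x)).1 x)
      (fun x => (J (fun x => q x * f x)).2 x - (J (fun x => q x * g x)).2 x)
      (fun x => q x * f x - q x * g x)) => //.
  - lra.
  - by rewrite mulr_ge0.
  - by rewrite f1 g1 subrr.
  - by rewrite f2 g2 subrr.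
  - by move=> t; rewrite -mulrBr normrM -mulrA ler_pM.
(* The iteration starts from [x], the solution for [q = 0] with the same initial data. *)
pose S := fix S (n : nat) (x : R) : R :=
  if n is n'.+1 then x - (J (fun x => q x * S n' x)).1 x else x.
have SS n (x : R) : S n.+1 x = x - (J (fun x => q x * S n x)).1 x by [].
have cS n : continuous (S n).
  elim: n => [|n IH] x; first exact: cvg_id.
  have [_ _ d _] := HJ _ (cqM _ IH).
  have cJ := is_derive_continuous (d x).
  apply: (@cvgB _ _ _ _ _ id (J (fun x => q x * S n x)).1); [exact: cvg_id|exact: cJ].
have S1 n (x : R) : `|S n.+1 x - S n x| <= 1 / 2 ^+ n.+1 * ch (K * x).
  elim: n x => [|n IH] x.
    have [f1 f2 f3 f4] := HJ _ (cqM _ (cS 0%N)).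
    have -> : S 1%N x - S 0%N x = - (J (fun x => q x * S 0%N x)).1 x.
      by rewrite SS -[S 0%N x]/x; ring.
    rewrite normrN expr1.
    apply: (@le_trans _ _ (Q / K ^+ 2 * ch (K * x))); last by rewrite ler_pM2r ?ch_gt0.
    apply: (second_antiderivative_bound _ Q0 f3 f4) => //; first lra.
    move=> t; rewrite normrM ler_pM//= (le_trans _ (norm_le_ch _))//.
    by rewrite normrM ger0_norm ?ler_peMl//; lra.
  have -> : S n.+2 x - S n.+1 x =
      (J (fun x => q x * S n x)).1 x - (J (fun x => q x * S n.+1 x)).1 x.
    by rewrite SS (SS n); ring.
  have -> : (1 / 2 ^+ n.+2 : R) = 1 / 2 ^+ n.+1 / 2.
    by rewrite [in LHS]exprS; field; rewrite expf_neq0.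
  apply: JB => //; last by move=> t; rewrite distrC.
have /choice[y Hy] : forall x, exists l, forall n, `|S n x - l| <= ch (K * x) / 2 ^+ n.
  move=> x; apply: (@geometric_limit (S ^~ x)) => n.
  by rewrite (le_trans (S1 n x))// mul1r mulrC.
have cy : continuous y.
  apply: (@locally_uniform_limit_continuous S y (fun x => ch (K * x))) => // x.
  apply: (@is_derive_continuous _ _ _ (K * (expR (K * x) - expR (- (K * x))))).
  by rewrite /ch; derive; ring.
have [f1 f2 f3 f4] := HJ _ (cqM _ cy).
(* The defect in the fixed-point equation is at most a constant over [2 ^+ n] for every [n]: it
   splits into [S n.+1 - y] and the image under [J] of [q (S n - y)]. *)
have yE (x : R) : y x = x - (J (fun x => q x * y x)).1 x.
  apply/subr0_eq/eqP; rewrite -normr_eq0; apply/eqP/le_anti/andP; split=> //.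
  set d := `|_|; have dn n : d <= (2 * ch (K * x)) / 2 ^+ n.
    have h1 := Hy x n.+1.
    have p0 : 0 <= 1 / 2 ^+ n :> R by rewrite divr_ge0// exprn_ge0.
    have h2 : `|(J (fun x => q x * S n x)).1 x - (J (fun x => q x * y x)).1 x|
       <= 1 / 2 ^+ n / 2 * ch (K * x).
      by apply: (JB _ _ _ (cS n) cy p0) => t; rewrite (le_trans (Hy t n))// mul1r mulrC.
    have -> : d = `| - (S n.+1 x - y x)
        - ((J (fun x => q x * S n x)).1 x - (J (fun x => q x * y x)).1 x)|.
      by rewrite /d SS; congr (`|_|); ring.
    rewrite (le_trans (ler_normB _ _))// normrN.
    apply: (le_trans (lerD h1 h2)); rewrite exprS.
    have -> : ch (K * x) / (2 * 2 ^+ n) + 1 / 2 ^+ n / 2 * ch (K * x) = ch (K * x) / 2 ^+ n.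
      by field; rewrite expf_neq0.
    by rewrite ler_pM2r ?invr_gt0 ?exprn_gt0// ler_peMl ?ler1n// ltW// ch_gt0.
  rewrite leNgt; apply/negP => d0.
  by have [n] := div_pow2_lt (2 * ch (K * x)) d0; rewrite ltNge dn.
exists y, (fun x => 1 - (J (fun x => q x * y x)).2 x); split.
- split => x; last first.
    by rewrite -sub0r; exact: (is_derive_fD (is_derive_fcst _ _) (is_derive_fN (f4 x))).
  have yE' t : t - (J (fun x => q x * y x)).1 t = y t by rewrite -yE.
  exact: (is_derive_ext yE' (is_derive_fD (is_derive_fid x) (is_derive_fN (f3 x)))).
- by rewrite yE f1 subr0.
- by rewrite f2 subr0.
Qed.

End HillExistence.

(** * Infinitely many periodic eigenvalues *)

Section MathieuSpectrum.
Variable R : realType.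
Variable alpha : R.
Implicit Types (y dy : R -> R) (lam : R).

Definition mathieu_pot lam (x : R) : R := lam + alpha * cos (2 * x).

Lemma mathieu_pot_bound lam x : `|mathieu_pot lam x| <= `|lam| + `|alpha|.
Proof.
rewrite /mathieu_pot (le_trans (ler_normD _ _))// lerD2l normrM ler_piMr//.
exact: cos_max.
Qed.

Lemma mathieu_potN lam x : mathieu_pot lam (- x) = mathieu_pot lam x.
Proof. by rewrite /mathieu_pot mulrN cosN. Qed.

Lemma mathieu_potDpi lam x : mathieu_pot lam (x + pi) = mathieu_pot lam x.
Proof. by rewrite /mathieu_pot mulrDr [2 * pi]mulr_natl cosD2pi. Qed.

Lemma continuous_mathieu_pot lam : continuous (mathieu_pot lam).
Proof.
move=> x; apply: (@is_derive_continuous _ _ _ (alpha * (- sin (2 * x) * 2))).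
by rewrite /mathieu_pot; derive; ring.
Qed.

Lemma mathieu_sol_hill lam y : mathieu_sol alpha lam y ->
  hill_sol (mathieu_pot lam) y (derive1 y).
Proof.
move=> [d1 [d2 e]]; split => x; first exact: derivable_is_derive.
rewrite (_ : - _ = derive1 (derive1 y) x); first exact: derivable_is_derive.
by have := e x; rewrite /mathieu_pot; lra.
Qed.

Lemma hill_mathieu_sol lam y dy : hill_sol (mathieu_pot lam) y dy ->
  mathieu_sol alpha lam y.
Proof.
move=> [d1 d2]; have dE : derive1 y = dy.
  by apply/funext => x; exact: is_derive_derive1.
split; first by move=> x; exact: ex_derive.
rewrite dE; split => x; first exact: ex_derive.
by rewrite (is_derive_derive1 (d2 x)) /mathieu_pot addNr.
Qed.

(** The potential is even about [0] and about [pi], so by uniqueness a zero of [y] there makes [y]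
    odd about that point. Composing the two reflections gives the translation by [2 * pi]. *)
Lemma dirichlet_periodic lam y dy : hill_sol (mathieu_pot lam) y dy ->
  y 0 = 0 -> y pi = 0 -> periodic2pi y.
Proof.
move=> s y0 ypi.
have qQ := mathieu_pot_bound lam.
have odd x : y x = -1 * y (- x).
  apply: (hill_unique (a := 0) qQ s
    (hill_sol_eqq (mathieu_potN lam) (hill_sol_scale (-1) (hill_sol_reflect s)))).
    by rewrite oppr0 y0 mulr0.
  by rewrite oppr0 mulrN mulN1r opprK.
have s1 := hill_sol_eqq (mathieu_potDpi lam) (hill_sol_shift pi s).
have s2 := hill_sol_eqq (mathieu_potN lam) (hill_sol_scale (-1) (hill_sol_reflect s1)).
have refl x : y (x + pi) = -1 * y (- x + pi).
  apply: (hill_unique (a := 0) qQ s1 s2); rewrite !oppr0 !add0r.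
    by rewrite ypi mulr0.
  by rewrite mulrN mulN1r opprK.
move=> x; have -> : x + 2 * pi = (x + pi) + pi by ring.
rewrite refl (_ : - (x + pi) + pi = - x); last by ring.
by rewrite -odd.
Qed.

(** * The shooting function: continuity and sign *)

Section Shooting.
Variables Y dY : R -> R -> R.
Hypothesis solY : forall lam, hill_sol (mathieu_pot lam) (Y lam) (dY lam).
Hypothesis Y0 : forall lam, Y lam 0 = 0.
Hypothesis dY0 : forall lam, dY lam 0 = 1.

(** The difference of two solutions has zero initial data and satisfies the equation with a forcing
    proportional to [lam0 - lam]; the energy estimate then gives a local Lipschitz bound. *)
Lemma shooting_continuous : continuous (fun lam => Y lam pi).
Proof.
(* The extra [1] makes [Q] bound the potentials of all [lam] within distance [1] of [lam0]. *)
move=> /= lam0; pose Q : R := `|lam0| + 1 + `|alpha|.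
have Q0 : 0 <= Q by rewrite !addr_ge0.
pose B := expR ((2 + Q) * pi).
have B1 : 1 <= B by rewrite /B -[leLHS]expR0 ler_expR mulr_ge0 ?pi_ge0//; lra.
have YB (x : R) : 0 <= x -> x <= pi -> Y lam0 x ^+ 2 <= B.
  move=> x0 xpi; have [d1 d2] := solY lam0.
  have d3 (t : R) : is_derive t 1 (dY lam0) (0 - mathieu_pot lam0 t * Y lam0 t).
    by rewrite sub0r.
  have qQ t : `|mathieu_pot lam0 t| <= Q.
    by rewrite (le_trans (mathieu_pot_bound _ _))// /Q; lra.
  have := hill_forcing_energy Q0 qQ d1 d3 x0 (S := 0).
  rewrite Y0 dY0 mul0r !expr0n /= expr1n !addr0 add0r mul1r subr0.
  move=> /(_ (fun _ _ _ => lexx _)) h.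
  apply: (le_trans (le_trans _ h)); first by rewrite lerDl sqr_ge0.
  by rewrite /B ler_expR ler_pM2l//; lra.
have lip lam : `|lam0 - lam| < 1 -> `|Y lam0 pi - Y lam pi| <= B * `|lam0 - lam|.
  move=> lam1; have [d1 d2] := solY lam0; have [d3 d4] := solY lam.
  pose z x := Y lam x - Y lam0 x; pose dz x := dY lam x - dY lam0 x.
  pose r x := (lam0 - lam) * Y lam0 x.
  have dz1 (t : R) : is_derive t 1 z (dz t) by rewrite /z /dz; derive.
  have dz2 (t : R) : is_derive t 1 dz (r t - mathieu_pot lam t * z t).
    by rewrite /z /dz /r; derive; rewrite /mathieu_pot; ring.
  have qQ t : `|mathieu_pot lam t| <= Q.
    rewrite (le_trans (mathieu_pot_bound _ _))// /Q lerD2r.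
    have -> : lam = lam0 - (lam0 - lam) by ring.
    by rewrite (le_trans (ler_normB _ _))// lerD2l ltW.
  have := hill_forcing_energy Q0 qQ dz1 dz2 (pi_ge0 R) (S := (lam0 - lam) ^+ 2 * B).
  have -> : z 0 = 0 by rewrite /z !Y0 subrr.
  have -> : dz 0 = 0 by rewrite /dz !dY0 subrr.
  rewrite !expr0n /= addr0 add0r subr0 -/B => h.
  have {}h : z pi ^+ 2 <= (B * `|lam0 - lam|) ^+ 2.
    apply: (@le_trans _ _ (z pi ^+ 2 + dz pi ^+ 2 + (lam0 - lam) ^+ 2 * B / (2 + Q))).
      have : 0 <= (lam0 - lam) ^+ 2 * B / (2 + Q).
        by apply: divr_ge0; [apply: mulr_ge0; [exact: sqr_ge0|lra]|lra].
      by have := sqr_ge0 (dz pi); lra.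
    apply: (le_trans (h _)).
      by move=> x x0 xpi; rewrite /r exprMn ler_wpM2l ?sqr_ge0 ?YB.
    rewrite exprMn real_normK ?num_real// [B ^+ 2]expr2 -mulrA [X in _ <= X]mulrC.
    rewrite !mulrA ler_pM2r; last lra.
    rewrite ler_pdivrMr; last lra.
    rewrite ler_peMr; [by []| | lra].
    by rewrite mulr_ge0 ?sqr_ge0//; lra.
  rewrite distrC -[Y lam pi - _]/(z pi) -ler_sqr ?nnegrE ?mulr_ge0//; last lra.
  by rewrite real_normK ?num_real.
apply/cvgrPdist_lt => /= e e0; near=> lam.
apply: (le_lt_trans (lip lam _)).
  by near: lam; exists 1 => //=.
rewrite mulrC -ltr_pdivlMr; last lra.
by near: lam; exists (e / B) => //=; rewrite divr_gt0//; lra.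
Unshelve. all: by end_near. Qed.

(** For [alpha = 0] the solution is [sin (om * x) / om], with value [(-1) ^+ n / om] at [pi]. The
    perturbation changes [om * y pi] by less than [1] once [om] is large. *)
Lemma shooting_sign (n : nat) : let om : R := n%:R + 1 / 2 in
  pi * (`|alpha| + 1) * (1 + expR 1) <= om ->
  0 < (-1) ^+ n * Y (om ^+ 2) pi.
Proof.
move=> om big; have om0 : 0 < om by rewrite /om ltr_wpDl// divr_gt0.
have omn : om != 0 by rewrite gt_eqF.
have pi0 := pi_gt0 R.
have a0 := normr_ge0 alpha.
have e1 := expR_gt0 (1 : R).
move: (solY (om ^+ 2)) (Y0 (om ^+ 2)) (dY0 (om ^+ 2)).
move: (Y _) (dY _) => y dy [d1 d2] y0 dy0.
pose c x : R := alpha * cos (2 * x).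
have cB x : `|c x| <= `|alpha| by rewrite /c normrM ler_piMr// cos_max.
(* Weighting [y] by [om] cancels the large part of the potential: [E' = - 2 c y y'], so [E] grows at
   a rate of at most [|alpha| / om]. Over [[0, pi]] the hypothesis on [om] limits this growth to the
   factor [expR 1]. *)
pose E x := dy x ^+ 2 + om ^+ 2 * y x ^+ 2.
pose C : R := (`|alpha| + 1) / om.
have C0 : 0 < C by rewrite divr_gt0//; lra.
have EB (x : R) : 0 <= x -> x <= pi -> E x <= expR 1.
  move=> x0 xpi.
  have := @gronwall _ E (fun t => - 2 * c t * y t * dy t) C 0 0 x C0 x0.
  rewrite mul0r !addr0 subr0 /E y0 dy0 expr0n /= mulr0 expr1n addr0 mul1r => h.
  apply: (le_trans (h _ _)).
  - move=> t; under eq_fun do rewrite !expr2; derive.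
    by rewrite /c /mathieu_pot; ring.
  - move=> t _ _; have := cB t; rewrite ler_norml => /andP[].
    move: (c t) (y t) (dy t) => p u v p1 p2.
    have h1 : - 2 * p * (om * u) * v <= `|alpha| * (v ^+ 2 + om ^+ 2 * u ^+ 2).
      have h4 : 0 <= (`|alpha| - p) * (om * u - v) ^+ 2.
        by rewrite mulr_ge0 ?sqr_ge0//; lra.
      have h5 : 0 <= (`|alpha| + p) * (om * u + v) ^+ 2.
        by rewrite mulr_ge0 ?sqr_ge0//; lra.
      lra.
    rewrite addr0 [C * _]mulrC /C mulrA ler_pdivlMr//.
    have := sqr_ge0 v; have := sqr_ge0 (om * u); lra.
  rewrite ler_expR /C mulrAC ler_pdivrMr// mul1r.
  apply: le_trans big; apply: (@le_trans _ _ ((`|alpha| + 1) * pi)).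
    by rewrite ler_pM2l//; lra.
  by rewrite mulrC ler_peMr//; [rewrite mulr_ge0//; lra|lra].
(* From [om ^+ 2 * y ^+ 2 <= expR 1] and [2 om |y| <= 1 + om ^+ 2 * y ^+ 2]. *)
pose D : R := `|alpha| * (1 + expR 1) / (2 * om).
have Da (x : R) : 0 <= x -> x <= pi -> `|c x * y x| <= D.
  move=> x0 xpi; rewrite normrM /D -mulrA ler_pM//.
  rewrite ler_pdivlMr; last lra.
  have : om ^+ 2 * y x ^+ 2 <= expR 1.
    by apply: le_trans (EB x x0 xpi); rewrite lerDr sqr_ge0.
  rewrite -[y x ^+ 2]real_normK ?num_real//; move: `|y x| => u h.
  by have := sqr_ge0 (1 - om * u); lra.
(* The first two terms have derivative [- c y cos (om * x)], of absolute value at most [D]; adding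
   [D * x] makes the sum nondecreasing. It equals [1] at [0]. *)
pose a (x : R) : R := dy x * cos (om * x) + om * y x * sin (om * x) + D * x.
have : a 0 <= a pi.
  apply: (@derive_ge0_le _ a (fun x => D - c x * y x * cos (om * x))) => //.
  - exact: ltW.
  - by move=> x; rewrite /a /c; derive; rewrite /mathieu_pot; ring.
  - move=> x x0 xpi; rewrite subr_ge0 (le_trans (ler_norm _))// normrM.
    by rewrite (le_trans _ (Da x x0 xpi))// ler_piMr// cos_max.
rewrite /a y0 dy0 mulr0 cos0 sin0 !mulr0 !addr0 mulr1.
(* The half-integer [om] makes the cosine vanish at the endpoint, so that only [y pi] survives
   there. *)
have -> : om * pi = pi / 2 + pi *+ n by rewrite /om -mulr_natl; ring.
rewrite (alternatingn (@sinDpi R)) (alternatingn (@cosDpi R)) sin_pihalf cos_pihalf.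
rewrite !mulr0 add0r mulr1.
have : D * pi < 1.
  rewrite /D mulrAC ltr_pdivrMr; last lra.
  rewrite mul1r; apply: (@le_lt_trans _ _ om); last lra.
  by apply: le_trans big; nra.
set s := (-1) ^+ n => h1 h2.
have : 0 < om * (s * y pi) by lra.
by rewrite pmulr_rgt0.
Qed.

End Shooting.

(** The set is shown to be unbounded above, whereas a finite set is compact and hence bounded. *)
Lemma mathieu_periodic_infinite : infinite_set [set lam : R | exists y : R -> R,
  mathieu_sol alpha lam y /\ periodic2pi y /\ exists x, y x != 0].
Proof.
have /choice[Y HY] : forall lam, exists y, exists dy,
    [/\ hill_sol (mathieu_pot lam) y dy, y 0 = 0 & dy 0 = 1].
  move=> lam; apply: hill_exists; first exact: continuous_mathieu_pot.
  exact: mathieu_pot_bound.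
have /choice[dY {}HY] := HY.
have solY lam : hill_sol (mathieu_pot lam) (Y lam) (dY lam) by have [] := HY lam.
have Y0 lam : Y lam 0 = 0 by have [] := HY lam.
have dY0 lam : dY lam 0 = 1 by have [] := HY lam.
have cF := shooting_continuous solY Y0 dY0.
have sgn := shooting_sign solY Y0 dY0.
set S := [set _ | _].
have unb (M : R) : exists2 lam, M <= lam & S lam.
  (* The first summand meets the size condition of [shooting_sign]; the second makes [om n ^+ 2]
     exceed [M]. *)
  pose M' : R := pi * (`|alpha| + 1) * (1 + expR 1) + `|M| + 1.
  have M'0 : `|M| + 1 <= M'.
    by rewrite /M' -addrA lerDr !mulr_ge0 ?pi_ge0// addr_ge0// expR_ge0.
  have [n nM] : exists n : nat, M' < n%:R.
    by exists (Num.Def.truncn M').+1; rewrite truncnS_gt.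
  have M0 := normr_ge0 M.
  pose om k : R := k%:R + 1 / 2.
  have s1 := sgn n; have s2 := sgn n.+1.
  have {}s1 : 0 < (-1) ^+ n * Y (om n ^+ 2) pi.
    by apply: s1; move: nM; rewrite /M'; lra.
  have {}s2 : 0 < (-1) ^+ n.+1 * Y (om n.+1 ^+ 2) pi.
    by apply: s2; move: nM; rewrite /M' -natr1; lra.
  have omle : om n ^+ 2 <= om n.+1 ^+ 2.
    by rewrite ler_sqr ?nnegrE ?addr_ge0 ?divr_ge0// /om lerD2r ler_nat.
  have [||c] := @IVT R (fun lam => Y lam pi) _ _ 0 omle.
  - exact: continuous_subspaceT.
  - move: (Y (om n ^+ 2) pi) (Y (om n.+1 ^+ 2) pi) s1 s2 => u v.
    rewrite exprS -signr_odd; case: (odd n); rewrite /= ?expr0 ?expr1 => s1 s2.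
    + by rewrite ge_min le_max; apply/andP; split; apply/orP; [left|right]; lra.
    + by rewrite ge_min le_max; apply/andP; split; apply/orP; [right|left]; lra.
  rewrite in_itv /= => /andP[c1 _] Yc; exists c.
    have := ler_norm M; move: c1 nM M'0; rewrite /om; nra.
  exists (Y c); split; first exact: hill_mathieu_sol (solY c).
  split; first exact: dirichlet_periodic (solY c) (Y0 c) Yc.
  (* The solution cannot vanish identically, because its derivative at [0] is [1]. *)
  apply: contrapT => Yn; have Yz x : Y c x = 0.
    by apply: contrapT => /eqP ne; apply: Yn; exists x.
  have [d _] := solY c.
  have := is_derive_derive1 (d 0); rewrite dY0 (_ : Y c = cst 0); last exact/funext.
  by rewrite derive1_cst => /eqP; rewrite eq_sym oner_eq0.
move=> /finite_compact /compact_bounded [M [_ Mb]].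
have [lam lamM Slam] := unb (M + 2).
have := Mb (M + 1) ltac:(lra) lam Slam.
by rewrite /=; have := ler_norm lam; lra.
Qed.

End MathieuSpectrum.

(** * Divided differences and local C^1 regularity *)

Section DividedDifference.
Variable R : realType.
Implicit Types x y : R.

Lemma near_prod (x0 y0 e : R) : 0 < e ->
  \forall z \near (x0, y0), `|x0 - z.1| < e /\ `|y0 - z.2| < e.
Proof.
move=> e0.
have c1 : z.1 @[z --> (x0, y0)] --> x0 by exact: cvg_fst.
have c2 : z.2 @[z --> (x0, y0)] --> y0 by exact: cvg_snd.
by near=> z; split; near: z; [move/cvgrPdist_lt : c1|move/cvgrPdist_lt : c2]; exact.
Unshelve. all: by end_near. Qed.

(** As [(x, y)] tends to a diagonal point, the intermediate point [c] is squeezed to it. This gives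
    continuity on the diagonal for both divided differences below. *)
Lemma mean_value_continuous (G : R -> R -> R) (g : R -> R) (x0 : R) :
  {for x0, continuous g} ->
  (forall x y, exists2 c, `|c - x| <= `|y - x| & G x y = g c) ->
  {for (x0, x0), continuous (fun z => G z.1 z.2)}.
Proof.
move=> cg mv; apply/cvgrPdist_lt => /= e e0.
have [c0] := mv x0 x0; rewrite subrr normr0 normr_le0 subr_eq0 => /eqP -> ->.
move/cvgrPdist_lt : cg => /(_ _ e0) [d /= d0 H].
have d4 : 0 < d / 4 by lra.
apply: filterS (near_prod x0 x0 d4) => -[x y] /= [].
have [c cx ->] := mv x y => h1 h2; apply: H => /=.
have := ler_distD x x0 c; rewrite (distrC x c).
have := ler_distD x0 y x; rewrite (distrC y x0); lra.
Qed.

(** Measuring by distance to [a] avoids ordering [a] and [b]. The conclusion [c != b] permits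
    cancelling a factor [b - c] later. *)
Lemma rolle_between (h dh : R -> R) (a b : R) : (forall x : R, is_derive x 1 h (dh x)) ->
  a != b -> h a = h b -> exists c, [/\ `|c - a| <= `|b - a|, c != b & dh c = 0].
Proof.
move=> d ab hab.
have rolle u v : u < v -> h u = h v -> exists2 c, u < c < v & dh c = 0.
  move=> uv huv; have [||c] := @Rolle R h u v uv _ _ huv.
  - by move=> x _; exact: ex_derive.
  - by apply: derivable_within_continuous => x _; exact: ex_derive.
  rewrite in_itv /= => cuv dc; exists c => //.
  by rewrite -(is_derive_derive1 (d c)) (is_derive_derive1 dc).
have [lt|lt|e] := ltgtP a b; last by rewrite e eqxx in ab.
- have [c /andP[h1 h2] dc] := rolle _ _ lt hab; exists c; split => //; last by rewrite lt_eqF.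
  by rewrite !gtr0_norm ?subr_gt0//; lra.
- have [c /andP[h1 h2] dc] := rolle _ _ lt (esym hab); exists c; split => //; last by rewrite gt_eqF.
  by rewrite !ltr0_norm ?subr_lt0//; lra.
Qed.

Variables phi dphi ddphi : R -> R.
Hypothesis dphiE : forall x : R, is_derive x 1 phi (dphi x).
Hypothesis ddphiE : forall x : R, is_derive x 1 dphi (ddphi x).
Hypothesis cddphi : continuous ddphi.

Definition divdiff (x y : R) : R :=
  if x == y then dphi x else (phi x - phi y) / (x - y).

(** The second divided difference with nodes [x, x, y], which is the [x]-derivative of [divdiff];
    its diagonal value is the Taylor coefficient. *)
Definition divdiffx (x y : R) : R :=
  if x == y then ddphi x / 2 else (dphi x - divdiff x y) / (x - y).

Lemma divdiffC x y : divdiff x y = divdiff y x.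
Proof.
rewrite /divdiff eq_sym; case: eqVneq => [->//|ne].
by rewrite -(opprB y x) -(opprB (phi y)) invrN mulrNN.
Qed.

Lemma divdiff_mean x y : exists2 c, `|c - x| <= `|y - x| & divdiff x y = dphi c.
Proof.
rewrite /divdiff; case: eqVneq => [->|ne]; first by exists y.
have n0 : x - y != 0 by rewrite subr_eq0.
pose k := (phi x - phi y) / (x - y).
have [|||c [cx _ e]] := @rolle_between (fun t => phi t - k * t) (fun t => dphi t - k) x y.
- by move=> t; derive; ring.
- exact: ne.
- by rewrite /k; field.
by exists c => //; rewrite -/k; lra.
Qed.

(** Taylor's formula with Lagrange remainder: Rolle applies to the Taylor polynomial at [t]
    evaluated in [y], plus [k (y - t)^2], where [k] is chosen to equate the values at [x] and
    [y]. *)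
Lemma divdiffx_mean x y : exists2 c, `|c - x| <= `|y - x| & divdiffx x y = ddphi c / 2.
Proof.
rewrite /divdiffx; case: eqVneq => [->|ne]; first by exists y.
have n0 : x - y != 0 by rewrite subr_eq0.
have n1 : y - x != 0 by rewrite subr_eq0 eq_sym.
pose k := (phi y - phi x - dphi x * (y - x)) / (y - x) ^+ 2.
have [|||c [cx cy e]] := @rolle_between
  (fun t => phi t + dphi t * (y - t) + k * ((y - t) * (y - t)))
  (fun t => (ddphi t - 2 * k) * (y - t)) x y.
- by move=> t; derive; ring.
- exact: ne.
- by rewrite /k; field.
exists c => //; rewrite /divdiff (negbTE ne).
move/eqP : e; rewrite mulf_eq0 (subr_eq0 y) [y == c]eq_sym (negbTE cy) orbF => /eqP e.
have -> : ddphi c / 2 = k by lra.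
by rewrite /k; field; rewrite ?n0 ?n1.
Qed.

(** Off the diagonal this is the quotient rule. On it, the difference quotient is a value of
    [divdiffx], to which the mean value form applies. *)
Lemma divdiff_derive x y : is_derive x 1 (divdiff ^~ y) (divdiffx x y).
Proof.
have [<-|ne] := eqVneq x y; last first.
  have n0 : x - y != 0 by rewrite subr_eq0.
  apply: (@is_derive_near_eq _ (fun t => (phi t - phi y) / (t - y))).
    have c1 : t - y @[t --> x] --> x - y by apply: cvgB; [exact: cvg_id|exact: cvg_cst].
    near=> t; rewrite /divdiff ifN// -subr_eq0.
    by near: t; exact: (cvgr_neq0 _ c1 n0).
  rewrite /divdiffx /divdiff (negbTE ne).
  derive; first exact: n0.
  by field.
suff lim : h^-1 *: (divdiff (h + x) x - divdiff x x) @[h --> 0^'] --> divdiffx x x.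
  split; last first.
    by apply: cvg_lim => //; under eq_fun do rewrite scaler1.
  by apply/cvg_ex; exists (divdiffx x x); under eq_fun do rewrite scaler1.
apply/cvgrPdist_lt => /= e e0.
move/cvgrPdist_lt : (@cddphi x) => /(_ _ e0) [d /= d0 H].
exists d => // h /=; rewrite sub0r normrN => hd hn0.
(* Symmetry of [divdiff] moves the increment to the second argument, where the quotient is
   [divdiffx] by definition. *)
have -> : h^-1 *: (divdiff (h + x) x - divdiff x x) = divdiffx x (h + x).
  have ne : x != h + x by rewrite -subr_eq0 opprD addrCA subrr addr0 oppr_eq0.
  rewrite divdiffC /divdiffx (negbTE ne) [divdiff x x]/divdiff eqxx /GRing.scale /=.
  have -> : x - (h + x) = - h by ring.
  by field.
have [c cx ->] := divdiffx_mean x (h + x).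
rewrite addrK in cx.
have -> : divdiffx x x = ddphi x / 2 by rewrite /divdiffx eqxx.
have := H c; rewrite /= distrC => /(_ (le_lt_trans cx hd)).
rewrite -mulrBl normrM [`|2^-1|]ger0_norm//.
have := normr_ge0 (ddphi x - ddphi c); lra.
Unshelve. all: by end_near. Qed.

Lemma divdiff_derivey x y : is_derive y 1 (divdiff x) (divdiffx y x).
Proof.
by apply: (is_derive_ext _ (divdiff_derive y x)) => t; rewrite divdiffC.
Qed.

Lemma divdiff_continuous : continuous (fun z : R * R => divdiff z.1 z.2).
Proof.
move=> [x y] /=; have [<-|ne] := eqVneq x y.
  apply: (mean_value_continuous _ divdiff_mean).
  exact: is_derive_continuous (ddphiE x).
have n0 : x - y != 0 by rewrite subr_eq0.
have c1 : z.1 - z.2 @[z --> (x, y)] --> x - y by apply: cvgB; [exact: cvg_fst|exact: cvg_snd].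
rewrite /prop_for /continuous_at /=.
have -> : divdiff x y = (phi x - phi y) / (x - y) by rewrite /divdiff (negbTE ne).
have c2 : phi z.1 - phi z.2 @[z --> (x, y)] --> phi x - phi y.
  apply: cvgB; apply: continuous_cvg.
  - exact: is_derive_continuous (dphiE x).
  - exact: cvg_fst.
  - exact: is_derive_continuous (dphiE y).
  - exact: cvg_snd.
apply: cvg_trans (cvgM c2 (cvgV n0 c1)).
apply: near_eq_cvg; near=> z; rewrite /= /divdiff ifN// -subr_eq0.
by near: z; exact: (cvgr_neq0 _ c1 n0).
Unshelve. all: by end_near. Qed.

Lemma divdiffx_continuous : continuous (fun z : R * R => divdiffx z.1 z.2).
Proof.
move=> [x y] /=; have [<-|ne] := eqVneq x y.
  apply: (@mean_value_continuous _ (fun t => ddphi t / 2)) divdiffx_mean.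
  by apply: cvgM; [exact: cddphi|exact: cvg_cst].
have n0 : x - y != 0 by rewrite subr_eq0.
have c1 : z.1 - z.2 @[z --> (x, y)] --> x - y by apply: cvgB; [exact: cvg_fst|exact: cvg_snd].
rewrite /prop_for /continuous_at /=.
have -> : divdiffx x y = (dphi x - divdiff x y) / (x - y) by rewrite /divdiffx (negbTE ne).
have c2 : dphi z.1 - divdiff z.1 z.2 @[z --> (x, y)] --> dphi x - divdiff x y.
  have c3 : divdiff z.1 z.2 @[z --> (x, y)] --> divdiff x y.
    exact: (@divdiff_continuous (x, y)).
  apply: cvgB c3; apply: continuous_cvg; last exact: cvg_fst.
  exact: is_derive_continuous (ddphiE x).
apply: cvg_trans (cvgM c2 (cvgV n0 c1)).
apply: near_eq_cvg; near=> z; rewrite /= /divdiffx ifN// -subr_eq0.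
by near: z; exact: (cvgr_neq0 _ c1 n0).
Unshelve. all: by end_near. Qed.

End DividedDifference.

(** * A pointwise form of C^1 regularity in two variables *)

Section LocalC1.
Variable R : realType.
Implicit Types (F G : R -> R -> R) (p : R * R).

(** Partial derivatives exist near [p] but are continuous only at [p]. The notion is stable under
    arithmetic and local changes of formula, and holding everywhere it yields [C1_2]. *)
Definition C1_at F p : Prop := exists Fx Fy : R -> R -> R,
  [/\ \forall z \near p, is_derive (z.1 : R) 1 (F ^~ z.2) (Fx z.1 z.2) /\
        is_derive (z.2 : R) 1 (F z.1) (Fy z.1 z.2),
      F z.1 z.2 @[z --> p] --> F p.1 p.2,
      Fx z.1 z.2 @[z --> p] --> Fx p.1 p.2 &
      Fy z.1 z.2 @[z --> p] --> Fy p.1 p.2].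

Lemma C1_at_C1_2 F : (forall p, C1_at F p) -> C1_2 F.
Proof.
move=> C; split.
  move=> x y; have [Fx [Fy [d _ _ _]]] := C (x, y).
  have [d1 d2] := nbhs_singleton d.
  by split; [exact: (ex_derive (is_derive := d1))|exact: (ex_derive (is_derive := d2))].
split; first by move=> p; have [Fx [Fy [_ c _ _]]] := C p.
split=> p; have [Fx [Fy [d c cx cy]]] := C p.
- rewrite /prop_for /continuous_at.
  rewrite (is_derive_derive1 (nbhs_singleton d).1); apply: cvg_trans cx.
  by apply: near_eq_cvg; apply: filterS d => z [/is_derive_derive1 -> _].
- rewrite /prop_for /continuous_at.
  rewrite (is_derive_derive1 (nbhs_singleton d).2); apply: cvg_trans cy.
  by apply: near_eq_cvg; apply: filterS d => z [_ /is_derive_derive1 ->].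
Qed.

Lemma near_slice1 (P : R * R -> Prop) (x y : R) :
  (\forall z \near (x, y), P z) -> \forall t \near x, P (t, y).
Proof.
have c : (t, y) @[t --> x] --> (x, y) by apply: (@cvg_pair _ _ _ _ (nbhs x) (nbhs y)); [exact: cvg_id|exact: cvg_cst].
by move=> h; exact: (c _ h).
Qed.

Lemma near_slice2 (P : R * R -> Prop) (x y : R) :
  (\forall z \near (x, y), P z) -> \forall t \near y, P (x, t).
Proof.
have c : (x, t) @[t --> y] --> (x, y) by apply: (@cvg_pair _ _ _ _ (nbhs x) (nbhs y)); [exact: cvg_cst|exact: cvg_id].
by move=> h; exact: (c _ h).
Qed.

Lemma C1_at_ext F G p : (\forall z \near p, F z.1 z.2 = G z.1 z.2) ->
  C1_at F p -> C1_at G p.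
Proof.
move=> FG [Fx [Fy [d c cx cy]]]; exists Fx, Fy; split => //.
- apply: filterS2 d (near_join FG) => -[x y] /= [d1 d2] e; split.
  + exact: (is_derive_near_eq (near_slice1 e) d1).
  + exact: (is_derive_near_eq (near_slice2 e) d2).
- rewrite -(nbhs_singleton FG); apply: cvg_trans c.
  by apply: near_eq_cvg; apply: filterS FG => z ->.
Qed.

Lemma C1_atM F G p : C1_at F p -> C1_at G p -> C1_at (fun x y => F x y * G x y) p.
Proof.
move=> [Fx [Fy [dF cF cFx cFy]]] [Gx [Gy [dG cG cGx cGy]]].
exists (fun x y => Fx x y * G x y + F x y * Gx x y),
  (fun x y => Fy x y * G x y + F x y * Gy x y); split.
- apply: filterS2 dF dG => z [d1 d2] [d3 d4].
  by split; [exact: (is_derive_fM d1 d3)|exact: (is_derive_fM d2 d4)].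
- exact: cvgM.
- by apply: cvgD; apply: cvgM.
- by apply: cvgD; apply: cvgM.
Qed.

Lemma C1_atB F G p : C1_at F p -> C1_at G p -> C1_at (fun x y => F x y - G x y) p.
Proof.
move=> [Fx [Fy [dF cF cFx cFy]]] [Gx [Gy [dG cG cGx cGy]]].
exists (fun x y => Fx x y - Gx x y), (fun x y => Fy x y - Gy x y); split.
- apply: filterS2 dF dG => z [d1 d2] [d3 d4]; split.
  + exact: (is_derive_fD d1 (is_derive_fN d3)).
  + exact: (is_derive_fD d2 (is_derive_fN d4)).
- exact: cvgB.
- exact: cvgB.
- exact: cvgB.
Qed.

Lemma C1_atV F p : F p.1 p.2 != 0 -> C1_at F p -> C1_at (fun x y => (F x y)^-1) p.
Proof.
move=> F0 [Fx [Fy [dF cF cFx cFy]]].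
have F20 : F p.1 p.2 * F p.1 p.2 != 0 by rewrite mulf_neq0.
exists (fun x y => - (Fx x y / F x y ^+ 2)), (fun x y => - (Fy x y / F x y ^+ 2)); split.
- apply: filterS2 dF (cvgr_neq0 _ cF F0) => z [d1 d2] z0.
  by split; [exact: (is_derive_fV z0 d1)|exact: (is_derive_fV z0 d2)].
- exact: cvgV.
- by apply: cvgN; apply: cvgM => //; apply: cvgV => //; apply: cvgM.
- by apply: cvgN; apply: cvgM => //; apply: cvgV => //; apply: cvgM.
Qed.

Lemma C1_at_fst (f df : R -> R) p : (forall x : R, is_derive x 1 f (df x)) ->
  continuous df -> C1_at (fun x _ => f x) p.
Proof.
move=> d c; exists (fun x _ => df x), (fun _ _ => 0); split.
- by apply: (@nearW _ (nbhs p)) => z; split; [exact: d|exact: is_derive_fcst].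
- by apply: continuous_cvg; [exact: is_derive_continuous (d _)|exact: cvg_fst].
- by apply: continuous_cvg; [exact: c|exact: cvg_fst].
- exact: cvg_cst.
Qed.

Lemma C1_at_snd (f df : R -> R) p : (forall x : R, is_derive x 1 f (df x)) ->
  continuous df -> C1_at (fun _ y => f y) p.
Proof.
move=> d c; exists (fun _ _ => 0), (fun _ y => df y); split.
- by apply: (@nearW _ (nbhs p)) => z; split; [exact: is_derive_fcst|exact: d].
- by apply: continuous_cvg; [exact: is_derive_continuous (d _)|exact: cvg_snd].
- exact: cvg_cst.
- by apply: continuous_cvg; [exact: c|exact: cvg_snd].
Qed.

Lemma C1_at_sub (f df : R -> R) p : (forall x : R, is_derive x 1 f (df x)) ->
  continuous df -> C1_at (fun x y => f (x - y)) p.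
Proof.
move=> d c; exists (fun x y => df (x - y)), (fun x y => - df (x - y)).
have cs : z.1 - z.2 @[z --> p] --> p.1 - p.2.
  by apply: cvgB; [exact: cvg_fst|exact: cvg_snd].
split.
- by apply: (@nearW _ (nbhs p)) => z; split; derive; ring.
- by apply: continuous_cvg cs; exact: is_derive_continuous (d _).
- by apply: continuous_cvg cs; exact: c.
- by apply: cvgN; apply: continuous_cvg cs; exact: c.
Qed.

Lemma C1_at_shift F (t x y : R) : C1_at F (x - t, y) ->
  C1_at (fun u v => F (u - t) v) (x, y).
Proof.
move=> [Fx [Fy [d c cx cy]]]; exists (fun u v => Fx (u - t) v), (fun u v => Fy (u - t) v).
have cs : (z.1 - t, z.2) @[z --> (x, y)] --> (x - t, y).
  apply: (@cvg_pair _ _ _ _ (nbhs (x - t)) (nbhs y)); last exact: cvg_snd.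
  by apply: cvgB; [exact: cvg_fst|exact: cvg_cst].
split.
- apply: (@filterS _ (nbhs (x, y)) _ _ _ _ (cs _ d)) => -[u v] /= [d1 d2]; split => //.
  have d3 : is_derive u 1 (fun s => s - t) (1 - 0).
    exact: (is_derive_fD (is_derive_fid _) (is_derive_fN (is_derive_fcst _ _))).
  by have := @is_derive_fcomp _ (F ^~ v) (fun s => s - t) u _ _ d1 d3; rewrite subr0 mulr1.
- exact: (cvg_comp _ _ cs c).
- exact: (cvg_comp _ _ cs cx).
- exact: (cvg_comp _ _ cs cy).
Qed.

End LocalC1.

(** * The kernel *)

Section MathieuKernel.
Variable R : realType.
Implicit Types x y t : R.

(** Subtracting the integer part of [s / pi] leaves a remainder in [[0, pi[], and sine is positive
    on the open interval. *)
Lemma sin_eq0 t : sin t = 0 -> exists n : nat, t = pi *+ n \/ t = - (pi *+ n).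
Proof.
suff pos (s : R) : 0 <= s -> sin s = 0 -> exists n : nat, s = pi *+ n.
  move=> st; have [/pos/(_ st)[n ->]|t0] := leP 0 t; first by exists n; left.
  have [||n e] := pos (- t); first by rewrite oppr_ge0 ltW.
    by rewrite sinN st oppr0.
  by exists n; right; rewrite -e opprK.
have pi0 := pi_gt0 R.
move=> s0 ss; have sp0 : 0 <= s / pi by rewrite divr_ge0 ?pi_ge0.
pose n := Num.Def.truncn (s / pi); exists n.
have /andP[n1 n2] : n%:R <= s / pi < n.+1%:R by exact: truncn_itv.
rewrite ler_pdivlMr ?ltr_pdivrMr// in n1 n2.
rewrite -natr1 in n2.
pose r := s - pi *+ n.
have sE : s = r + pi *+ n by rewrite /r subrK.
move: ss; rewrite sE (alternatingn (@sinDpi R)) => /eqP.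
rewrite mulf_eq0 signr_eq0 /= => /eqP sr.
have -> : r = 0; last by rewrite add0r.
apply/eqP; apply/negPn/negP => r0; have : 0 < sin r; last by rewrite sr ltxx.
apply: sin_gt0_pi; rewrite lt_neqAle eq_sym r0 /= /r -mulr_natl; apply/andP; split; lra.
Qed.

Variables (alpha lam : R) (A dA : R -> R).
Hypothesis solA : hill_sol (mathieu_pot alpha lam) A dA.
Hypothesis perA : periodic2pi A.
Hypothesis nzA : exists x, A x != 0.

Definition mathieu_d2 x : R := - (mathieu_pot alpha lam x * A x).

Let dAE x : is_derive x 1 A (dA x). Proof. exact: solA.1. Qed.
Let ddAE x : is_derive x 1 dA (mathieu_d2 x). Proof. exact: solA.2. Qed.

Lemma shift_derivative (t e : R) : (forall x, A (x + t) = e * A x) ->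
  forall x, dA (x + t) = e * dA x.
Proof.
move=> h x; have d1 : is_derive x 1 (fun x => A (x + t)) (dA (x + t)) by derive; ring.
have d2 : is_derive x 1 (fun x => e * A x) (e * dA x) by derive; ring.
by rewrite -(is_derive_derive1 d1) -(is_derive_derive1 d2); congr (derive1 _ x); exact/funext.
Qed.

Let perdA x : dA (x + 2 * pi) = dA x.
Proof. by rewrite (@shift_derivative _ 1) ?mul1r// => t; rewrite mul1r perA. Qed.

(** The Wronskian [w] of [A] and its shift by [pi] is constant and changes sign under that shift, so
    it is zero. The factor [e] is read off at a point where [A] is nonzero, and [e * e = 1] comes
    from the period [2 * pi]. *)
Lemma half_period : exists2 e : R, e * e = 1 & forall x, A (x + pi) = e * A x.
Proof.
pose w x := A (x + pi) * dA x - dA (x + pi) * A x.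
have dw x : is_derive x 1 w 0.
  rewrite /w; derive; rewrite /mathieu_d2 mathieu_potDpi; ring.
have w0 x : w x = 0.
  have : w (x + pi) = - w x.
    rewrite /w (_ : x + pi + pi = x + 2 * pi); last by ring.
    by rewrite perA perdA; ring.
  rewrite (derive_0_eq (x + pi) x dw); lra.
have [x0 x0n] := nzA.
pose e := A (x0 + pi) / A x0.
have eA x : A (x + pi) = e * A x.
  apply: (hill_unique (a := x0) (mathieu_pot_bound alpha lam)
    (hill_sol_eqq (mathieu_potDpi alpha lam) (hill_sol_shift pi solA)) (hill_sol_scale e solA)).
  - by rewrite /e divfK.
  - apply: (mulIf x0n); rewrite /e mulrAC divfK//.
    by have := w0 x0; rewrite /w; lra.
exists e => //; apply: (mulIf x0n); rewrite mul1r -mulrA -eA -eA.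
by rewrite (_ : x0 + pi + pi = x0 + 2 * pi) ?perA//; ring.
Qed.

(** Iterates [half_period]; shifts by [pi *+ n] to the left and to the right have the same factor
    because [e * e = 1]. *)
Lemma sin_eq0_shift t : sin t = 0 -> exists e : R, forall x, A (x + t) = e * A x.
Proof.
have [e e1 he] := half_period.
have hn n x : A (x + pi *+ n) = e ^+ n * A x.
  elim: n x => [|n IH] x; first by rewrite mulr0n addr0 expr0 mul1r.
  by rewrite mulrSr addrA he IH exprS mulrA.
move=> /sin_eq0[n [->|->]]; exists (e ^+ n) => x //.
rewrite -[in RHS](subrK (pi *+ n) x) hn mulrA -exprMn e1 expr1n mul1r //.
Qed.

Lemma sin_eq0_cos_neq0 t : sin t = 0 -> cos t != 0.
Proof.
move=> st; apply/eqP => ct; have := cos2Dsin2 t.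
by rewrite st ct !expr0n /= addr0 => /eqP; rewrite eq_sym oner_eq0.
Qed.

Lemma sin_eq0_pot t : sin t = 0 -> forall x,
  mathieu_pot alpha lam (x + t) = mathieu_pot alpha lam x.
Proof.
move=> st x.
have s2 : sin (2 * t) = 0 by rewrite mulr_natl sin_mulr2n st mulr0 mul0rn.
have c2 : cos (2 * t) = 1 by rewrite mulr_natl cos_mulr2n cos2sin2 st expr0n /= subr0; ring.
by rewrite /mathieu_pot mulrDr cosD s2 c2 mulr1 mulr0 subr0.
Qed.

(** Where the sine vanishes, the value is the l'Hopital quotient: the [x]-derivatives of numerator
    and denominator. *)
Definition mathieu_kernel x y : R := if sin (x - y) == 0
  then (dA x * dA y - mathieu_d2 x * A y) / cos (x - y)
  else (A x * dA y - dA x * A y) / sin (x - y).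

Lemma mathieu_kernelE x y : sin (x - y) != 0 ->
  mathieu_kernel x y = (A x * dA y - dA x * A y) / sin (x - y).
Proof. by rewrite /mathieu_kernel => /negbTE ->. Qed.

Lemma sin_mathieu_kernel x y : sin (x - y) * mathieu_kernel x y = A x * dA y - dA x * A y.
Proof.
have [s0|s0] := eqVneq (sin (x - y)) 0; last first.
  by rewrite mathieu_kernelE//; field.
rewrite s0 mul0r; have [e eA] := sin_eq0_shift s0.
have := eA y; have := shift_derivative eA y; rewrite addrC subrK => -> ->.
by ring.
Qed.

(** Numerator and denominator are both antisymmetric. Where the sine vanishes, the potentials at [x]
    and [y] agree, which makes the l'Hopital value symmetric too. *)
Lemma mathieu_kernelC x y : mathieu_kernel x y = mathieu_kernel y x.
Proof.
rewrite /mathieu_kernel -(opprB x y) sinN oppr_eq0 cosN.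
case: eqP => [s0|/eqP s0]; last by field.
congr (_ / _); have := sin_eq0_pot s0 y; rewrite addrC subrK /mathieu_d2 => ->; ring.
Qed.

Lemma mathieu_kernel_periodic x y : mathieu_kernel (x + 2 * pi) y = mathieu_kernel x y.
Proof.
have e2 : x + 2 * pi - y = (x - y) + pi *+ 2 by rewrite -mulr_natl; ring.
have e3 : mathieu_pot alpha lam (x + 2 * pi) = mathieu_pot alpha lam x.
  by rewrite mulr_natl mulr2n addrA !mathieu_potDpi.
by rewrite /mathieu_kernel e2 sinD2pi cosD2pi perA perdA /mathieu_d2 e3 perA.
Qed.

Let continuous_ddA : continuous mathieu_d2.
Proof.
move=> x; apply: cvgN; apply: cvgM; first exact: continuous_mathieu_pot.
exact: is_derive_continuous (dAE x).
Qed.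

Let continuous_dA : continuous dA.
Proof. by move=> x; exact: is_derive_continuous (ddAE x). Qed.

Let continuous_A : continuous A.
Proof. by move=> x; exact: is_derive_continuous (dAE x). Qed.

(** The third derivative of [A]. Its continuity is what makes the divided difference of [dA]
    continuously differentiable. *)
Definition mathieu_d3 x : R := - (- alpha * (2 * sin (2 * x)) * A x + mathieu_pot alpha lam x * dA x).

Let dddAE x : is_derive x 1 mathieu_d2 (mathieu_d3 x).
Proof. by rewrite /mathieu_d2 /mathieu_d3 /mathieu_pot; derive; ring. Qed.

Let continuous_dddA : continuous mathieu_d3.
Proof.
have d x : is_derive x 1 mathieu_d3 (- (- alpha * (2 * (cos (2 * x) * 2)) * A x
    + - alpha * (2 * sin (2 * x)) * dA x
    + (- alpha * (2 * sin (2 * x)) * dA x + mathieu_pot alpha lam x * mathieu_d2 x))).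
  by rewrite /mathieu_d3 /mathieu_pot; derive; ring.
by move=> x; exact: is_derive_continuous (d x).
Qed.

Lemma mathieu_kernel_C1_regular x y : sin (x - y) != 0 -> C1_at mathieu_kernel (x, y).
Proof.
move=> s0; apply: (@C1_at_ext _ (fun x y => (A x * dA y - dA x * A y) * (sin (x - y))^-1)).
  have c : sin (z.1 - z.2) @[z --> (x, y)] --> sin (x - y).
    apply: continuous_cvg; first exact: continuous_sin.
    by apply: cvgB; [exact: cvg_fst|exact: cvg_snd].
  by apply: filterS (cvgr_neq0 _ c s0) => z /= z0; rewrite mathieu_kernelE.
apply: C1_atM.
  apply: C1_atB; apply: C1_atM.
  - exact: C1_at_fst continuous_dA.
  - exact: C1_at_snd continuous_ddA.
  - exact: C1_at_fst continuous_ddA.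
  - exact: C1_at_snd continuous_dA.
apply: C1_atV => //.
exact: (@C1_at_sub _ (@sin R) (@cos R) _ (@is_derive_sin R) (@continuous_cos R)).
Qed.

Lemma sin_neq0 t : `|t| < pi -> t != 0 -> sin t != 0.
Proof.
move=> tpi t0; have [tp|tn] := leP 0 t.
  rewrite gt_eqF// sin_gt0_pi// lt_neqAle eq_sym t0 tp /=.
  by rewrite ger0_norm in tpi.
rewrite -oppr_eq0 -sinN gt_eqF// sin_gt0_pi// oppr_gt0 tn /=.
by rewrite ltr0_norm in tpi.
Qed.

Let sincos0 t : divdiff (@sin R) (@cos R) t 0 = if t == 0 then cos t else sin t / t.
Proof. by rewrite /divdiff sin0 !subr0. Qed.

(** Shifting [u] by [t] moves the singular line to the diagonal, at the cost of the constant
    [e / cos t]. There both the numerator and the sine are divided by the difference of the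
    arguments, leaving divided differences. *)
Lemma mathieu_kernel_C1_singular x y : sin (x - y) = 0 -> C1_at mathieu_kernel (x, y).
Proof.
have [t tE] : exists t, t = x - y by exists (x - y).
rewrite -tE => st.
have [e eA] := sin_eq0_shift st.
have edA := shift_derivative eA.
have eddA u : mathieu_d2 (u + t) = e * mathieu_d2 u by rewrite /mathieu_d2 (sin_eq0_pot st) eA; ring.
have ct := sin_eq0_cos_neq0 st.
(* Uses [A u * dA v - dA u * A v = (A u - A v) * dA v - (dA u - dA v) * A v]; the inverted factor is
   [sin s / s] at [s = u - v]. *)
pose V u v := (divdiff A dA u v * dA v - divdiff dA mathieu_d2 u v * A v) *
  (divdiff (@sin R) (@cos R) (u - v) 0)^-1.
apply: (@C1_at_ext _ (fun u v => e / cos t * V (u - t) v)).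
  have c : z.1 - t - z.2 @[z --> (x, y)] --> x - t - y.
    apply: cvgB; last exact: cvg_snd.
    by apply: cvgB; [exact: cvg_fst|exact: cvg_cst].
  (* Within distance [pi] of the singular line the sine has no other zero. *)
  move/cvgrPdist_lt : c => /(_ _ (pi_gt0 R)); apply: filterS => -[u v] /=.
  rewrite (_ : x - t - y = 0) ?sub0r ?normrN; last by rewrite tE; ring.
  move: (u - t) (subrK t u) => s <- sv.
  rewrite /mathieu_kernel (_ : s + t - v = s - v + t); last by ring.
  have -> : sin (s - v + t) = sin (s - v) * cos t by rewrite sinD st; ring.
  have -> : cos (s - v + t) = cos (s - v) * cos t by rewrite cosD st; ring.
  rewrite mulf_eq0 (negbTE ct) orbF.
  rewrite eA edA eddA /V sincos0 /divdiff subr_eq0.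
  have [->|ne] := eqVneq s v.
    by rewrite !subrr sin0 cos0 eqxx; field.
  have n0 : s - v != 0 by rewrite subr_eq0.
  have sn := sin_neq0 sv n0.
  by rewrite (negbTE sn); field; rewrite ct n0 sn.
apply: C1_atM; first exact: (@C1_at_fst _ (fun=> e / cos t) (fun=> 0) _ (is_derive_fcst _) (fun x => cvg_cst _)).
apply: C1_at_shift.
have ddC (f df ddf : R -> R) p : (forall x, is_derive x 1 f (df x)) ->
    (forall x, is_derive x 1 df (ddf x)) -> continuous ddf ->
    C1_at (divdiff f df) p.
  move=> d1 d2 c; exists (divdiffx f df ddf), (fun x y => divdiffx f df ddf y x); split.
  - apply: (@nearW _ (nbhs p)) => z; split.
    + exact: divdiff_derive.
    + exact: divdiff_derivey.
  - exact: (@divdiff_continuous _ _ _ _ d1 d2 p).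
  - exact: (@divdiffx_continuous _ _ _ _ d1 d2 c p).
  - have cs : (z.2, z.1) @[z --> p] --> (p.2, p.1).
      by apply: (@cvg_pair _ _ _ _ (nbhs p.2) (nbhs p.1)); [exact: cvg_snd|exact: cvg_fst].
    exact: (cvg_comp _ _ cs (@divdiffx_continuous _ _ _ _ d1 d2 c (p.2, p.1))).
apply: C1_atM.
  apply: C1_atB; apply: C1_atM.
  - exact: ddC continuous_ddA.
  - exact: C1_at_snd continuous_ddA.
  - exact: ddC continuous_dddA.
  - exact: C1_at_snd continuous_dA.
apply: C1_atV.
  by rewrite /= (_ : x - t - y = 0) ?sincos0 ?eqxx ?cos0 ?oner_eq0//; rewrite tE; ring.
have dcos (u : R) : is_derive u 1 (@cos R) (- sin u) by exact: is_derive_cos.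
have cNs : continuous (fun u : R => - sin u) by move=> u; apply: cvgN; exact: continuous_sin.
apply: (@C1_at_sub _ (fun u => divdiff (@sin R) (@cos R) u 0)
  (fun u => divdiffx (@sin R) (@cos R) (fun u => - sin u) u 0)).
  by move=> u; apply: divdiff_derive => // v; exact: is_derive_sin.
move=> u; have cs : (v, 0 : R) @[v --> u] --> (u, 0 : R).
  by apply: (@cvg_pair _ _ _ _ (nbhs u) (nbhs (0 : R))); [exact: cvg_id|exact: cvg_cst].
have dsin (v : R) : is_derive v 1 (@sin R) (cos v) by exact: is_derive_sin.
exact: (cvg_comp _ _ cs (@divdiffx_continuous _ _ _ _ dsin dcos cNs (u, 0))).
Qed.

Lemma mathieu_kernel_C1 : C1_2 mathieu_kernel.
Proof.
apply: C1_at_C1_2 => -[x y]; have [s0|s0] := eqVneq (sin (x - y)) 0.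
  exact: mathieu_kernel_C1_singular.
exact: mathieu_kernel_C1_regular.
Qed.

(** The operator [d/dx + d/dy] annihilates functions of [x - y], so it acts on the numerator only
    and gives [A x * A'' y - A'' x * A y]. By the equation this is
    [alpha (cos 2x - cos 2y) A x A y], which contains the factor [sin (x - y)]. *)
Let transport_regular x y : sin (x - y) != 0 ->
  derive1 (mathieu_kernel ^~ y) x + derive1 (mathieu_kernel x) y =
  - 2 * alpha * sin (x + y) * (A x * A y).
Proof.
move=> s0.
have d1 : is_derive x 1 (mathieu_kernel ^~ y)
    ((dA x * dA y - mathieu_d2 x * A y) * (sin (x - y))^-1 +
     (A x * dA y - dA x * A y) * - (cos (x - y) / sin (x - y) ^+ 2)).
  apply: (@is_derive_near_eq _ (fun x => (A x * dA y - dA x * A y) * (sin (x - y))^-1)).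
    have c : sin (t - y) @[t --> x] --> sin (x - y).
      apply: continuous_cvg; first exact: continuous_sin.
      by apply: cvgB; [exact: cvg_id|exact: cvg_cst].
    by apply: filterS (cvgr_neq0 _ c s0) => t t0; rewrite mathieu_kernelE.
  by derive; [exact: s0|field].
have d2 : is_derive y 1 (mathieu_kernel x)
    ((A x * mathieu_d2 y - dA x * dA y) * (sin (x - y))^-1 +
     (A x * dA y - dA x * A y) * (cos (x - y) / sin (x - y) ^+ 2)).
  apply: (@is_derive_near_eq _ (fun y => (A x * dA y - dA x * A y) * (sin (x - y))^-1)).
    have c : sin (x - t) @[t --> y] --> sin (x - y).
      apply: continuous_cvg; first exact: continuous_sin.
      by apply: cvgB; [exact: cvg_cst|exact: cvg_id].
    by apply: filterS (cvgr_neq0 _ c s0) => t t0; rewrite mathieu_kernelE.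
  by derive; [exact: s0|field].
rewrite (is_derive_derive1 d1) (is_derive_derive1 d2).
have -> : - 2 * alpha * sin (x + y) * (A x * A y) =
    (A x * mathieu_d2 y - mathieu_d2 x * A y) * (sin (x - y))^-1; last by field.
have cxy : cos (2 * x) - cos (2 * y) = - 2 * sin (x + y) * sin (x - y).
  have -> : 2 * x = (x + y) + (x - y) by ring.
  have -> : 2 * y = (x + y) - (x - y) by ring.
  by move: (x + y) (x - y) => u v; rewrite cosD cosB; ring.
have -> : A x * mathieu_d2 y - mathieu_d2 x * A y = alpha * (cos (2 * x) - cos (2 * y)) * (A x * A y).
  by rewrite /mathieu_d2 /mathieu_pot; ring.
by rewrite cxy; field.
Qed.

(* Along the diagonal direction the singular denominator is constant, so the
   kernel has a smooth derivative of rank two there. *)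
Lemma mathieu_kernel_transport x y :
  derive1 (mathieu_kernel ^~ y) x + derive1 (mathieu_kernel x) y =
  - 2 * alpha * sin (x + y) * (A x * A y).
Proof.
have [s0|] := eqVneq (sin (x - y)) 0; last exact: transport_regular.
have [_ [_ [cx cy]]] := mathieu_kernel_C1.
(* The defect of the identity, continuous at [x]. If nonzero there, it would stay nonzero at nearby
   [t], where the sine no longer vanishes and the regular case applies. *)
pose H (t : R) : R := derive1 (mathieu_kernel ^~ y) t + derive1 (mathieu_kernel t) y
  - - 2 * alpha * sin (t + y) * (A t * A y).
have cs : (t, y) @[t --> x] --> (x, y).
  by apply: (@cvg_pair _ _ _ _ (nbhs x) (nbhs y)); [exact: cvg_id|exact: cvg_cst].
have cH : H t @[t --> x] --> H x.
  apply: cvgB; first apply: cvgD.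
  - exact: (cvg_comp _ _ cs (cx (x, y))).
  - exact: (cvg_comp _ _ cs (cy (x, y))).
  apply: cvgM; last by apply: cvgM; [exact: continuous_A|exact: cvg_cst].
  apply: cvgM; first exact: cvg_cst.
  apply: continuous_cvg; first exact: continuous_sin.
  by apply: cvgD; [exact: cvg_id|exact: cvg_cst].
apply/subr0_eq; rewrite -/(H x); apply/eqP; apply/negPn/negP => Hx.
have [d /= d0 Hd] := cvgr_neq0 _ cH Hx.
(* Below [d] to stay in the neighbourhood, and below [pi] so that [sin h] is nonzero. *)
pose h : R := Num.min d pi / 2.
have pi0 := pi_gt0 R.
have h0 : 0 < h by rewrite divr_gt0// lt_min d0 pi0.
have hd : h < d by rewrite /h ltr_pdivrMr// gt_min; apply/orP; left; lra.
have hpi : h < pi by rewrite /h ltr_pdivrMr// gt_min; apply/orP; right; lra.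
have Hn : H (x + h) != 0.
  by apply: Hd; rewrite /= opprD addrA subrr sub0r normrN gtr0_norm.
move/eqP : Hn; apply.
rewrite /H transport_regular ?subrr//.
rewrite (_ : x + h - y = h + (x - y)); last by ring.
rewrite sinD s0 mulr0 addr0 mulf_neq0 ?sin_eq0_cos_neq0//.
by rewrite sin_neq0 ?gt_eqF// gtr0_norm.
Qed.

End MathieuKernel.

(** * Integral operators on [0, 2 pi] *)

Section IntegralOperators.
Variable R : realType.
Notation mu := (@lebesgue_measure R).
Notation I := (@I02 R).
Implicit Types (f g h : R -> R) (x y : R).

Lemma measurable_I02 : @measurable _ (measurableTypeR R) I.
Proof. exact: (measurable_itv `[0, 2 * pi]). Qed.

Lemma compact_I02 : compact I.
Proof. exact: segment_compact. Qed.

Lemma mu_I02_lty : (mu I < +oo)%E.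
Proof.
by rewrite /I02 lebesgue_measure_itv /=; case: ifP => _; rewrite ?ltry.
Qed.

Let mI := measurable_I02.

Lemma continuous_measurable f : continuous f ->
  @measurable_fun _ _ (measurableTypeR R) R I f.
Proof.
move=> cf; apply: (measurable_funS measurableT) => //.
exact: continuous_measurable_fun.
Qed.

Lemma continuous_bounded_I02 f : continuous f -> [bounded f x | x in I].
Proof.
move=> cf.
have [M [Mr MM]] : bounded_set (f @` I).
  apply: compact_bounded; apply: continuous_compact; last exact: compact_I02.
  exact: continuous_subspaceT.
by exists M; split => // N MN x Ix; apply: MM => //; exists x.
Qed.

Lemma integrable_continuousM f g : continuous g -> mu.-integrable I (EFin \o f) ->
  mu.-integrable I (EFin \o (fun y => g y * f y)).
Proof.
move=> cg fi; have := integrableMr mI (continuous_measurable cg) (continuous_bounded_I02 cg) fi.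
by apply: eq_integrable => // y _ /=; rewrite EFinM.
Qed.

Lemma continuous_integrable_I02 f : continuous f -> mu.-integrable I (EFin \o f).
Proof.
move=> cf; apply: measurable_bounded_integrable => //.
- exact: mu_I02_lty.
- exact: continuous_measurable.
- exact: continuous_bounded_I02.
Qed.

Lemma continuous_sq_int f : continuous f -> sq_int f.
Proof.
move=> cf; split; first exact: continuous_measurable.
by apply: (@continuous_integrable_I02 (fun x => f x ^+ 2)) => x; apply: cvgM; exact: cf.
Qed.

(** [|f| <= 1 + f^2], and constants are integrable on a bounded interval. *)
Lemma sq_int_integrable f : sq_int f -> mu.-integrable I (EFin \o f).
Proof.
move=> [mf f2].
have i1 : mu.-integrable I (EFin \o (fun x => 1 + f x ^+ 2)).
  have c1 : continuous (fun _ : R => 1 : R) by move=> x; exact: cvg_cst.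
  have := integrableD mI (continuous_integrable_I02 c1) f2.
  by apply: eq_integrable.
apply: le_integrable i1 => //; first exact/measurable_EFinP.
move=> x _ /=; rewrite lee_fin [leRHS]ger0_norm ?addr_ge0 ?sqr_ge0//.
rewrite -real_normK ?num_real//; have := sqr_ge0 (`|f x| - 1); have := normr_ge0 (f x).
by lra.
Qed.

(** Compactness of the rectangle. The constant [M] provides the dominating function [M * |f y|] for
    limits under the integral. *)
Lemma rectangle_bound (F : R -> R -> R) a b : continuous (fun z : R * R => F z.1 z.2) ->
  exists2 M : R, 0 <= M & forall x y, a <= x -> x <= b -> I y -> `|F x y| <= M.
Proof.
move=> cF; have K : compact (`[a, b]%classic `*` I).
  by apply: compact_setX; [exact: segment_compact|exact: compact_I02].
have [M [Mr MM]] : bounded_set ((fun z : R * R => F z.1 z.2) @` (`[a, b]%classic `*` I)).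
  apply: compact_bounded; apply: continuous_compact K.
  exact: continuous_subspaceT.
exists (`|M| + 1) => // x y ax xb Iy; apply: MM.
  by rewrite (le_lt_trans (ler_norm M))// ltrDl.
by exists (x, y) => //; split => //=; rewrite in_itv /= ax xb.
Qed.

Lemma continuous_slice (F : R -> R -> R) x : continuous (fun z : R * R => F z.1 z.2) ->
  continuous (F x).
Proof.
move=> cF y; have cs : (x, t) @[t --> y] --> (x, y).
  by apply: (@cvg_pair _ _ _ _ (nbhs x) (nbhs y)); [exact: cvg_cst|exact: cvg_id].
exact: (cvg_comp _ _ cs (cF (x, y))).
Qed.

Lemma continuous_slice1 (F : R -> R -> R) y : continuous (fun z : R * R => F z.1 z.2) ->
  continuous (F ^~ y).
Proof.
move=> cF x; have cs : (t, y) @[t --> x] --> (x, y).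
  by apply: (@cvg_pair _ _ _ _ (nbhs x) (nbhs y)); [exact: cvg_id|exact: cvg_cst].
exact: (cvg_comp _ _ cs (cF (x, y))).
Qed.

Lemma intop_continuous (F : R -> R -> R) f : continuous (fun z : R * R => F z.1 z.2) ->
  mu.-integrable I (EFin \o f) -> continuous (intop F f).
Proof.
move=> cF fi a; have [M M0 FM] := rectangle_bound (a - 1) (a + 1) cF.
have aI : a \in (`]a - 1, a + 1[%classic : set R).
  by apply/mem_set; rewrite /= in_itv /=; apply/andP; split; lra.
apply: (@continuity_under_integral R _ _ mu (fun x y => F x y * f y) I mI (a - 1) (a + 1)
  _ _ (fun y => M * `|f y|) _ _ a aI).
- move=> x _; apply: integrable_continuousM => //; exact: continuous_slice.
- apply: aeW => y _ x _; apply: cvgM; last exact: cvg_cst.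
  exact: (@continuous_slice1 F y cF).
- have := integrableZl mI M (integrable_norm fi).
  by apply: eq_integrable.
- move=> x; rewrite /= in_itv /= => /andP[h1 h2]; apply: aeW => y Iy.
  by rewrite normrM ler_wpM2r// FM// ltW.
Qed.

Lemma intop_is_derive (F Fx : R -> R -> R) f :
  (forall x y, is_derive x 1 (F ^~ y) (Fx x y)) ->
  continuous (fun z : R * R => F z.1 z.2) -> continuous (fun z : R * R => Fx z.1 z.2) ->
  mu.-integrable I (EFin \o f) -> forall x, is_derive x 1 (intop F f) (intop Fx f x).
Proof.
move=> dF cF cFx fi a; have [M M0 FM] := rectangle_bound (a - 1) (a + 1) cFx.
have aI : (`]a - 1, a + 1[%classic : set R) a.
  by rewrite /= in_itv /=; apply/andP; split; lra.
have d x y : is_derive x 1 (fun t => F t y * f y) (Fx x y * f y).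
  have := is_derive_fM (dF x y) (is_derive_fcst (f y) x).
  by rewrite mulr0 addr0.
have h1 x : `]a - 1, a + 1[%classic x -> mu.-integrable I (EFin \o (fun y => F x y * f y)).
  move=> _; apply: integrable_continuousM => //; exact: continuous_slice.
have h2 x y : `]a - 1, a + 1[%classic x -> I y -> derivable (fun t => F t y * f y) x 1.
  by move=> _ _; exact: (@ex_derive _ _ _ _ _ _ _ (d x y)).
have h3 : forall y, 0 <= M * `|f y| by move=> y; rewrite mulr_ge0.
have h4 : mu.-integrable I (EFin \o (fun y => M * `|f y|)).
  have := integrableZl mI M (integrable_norm fi).
  by apply: eq_integrable.
have h5 x y : `]a - 1, a + 1[%classic x -> I y ->
    `|partial1of2 (fun x y => F x y * f y) x y| <= M * `|f y|.
  rewrite /= in_itv /= => /andP[u1 u2] Iy.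
  by rewrite /partial1of2 (is_derive_derive1 (d x y)) normrM ler_wpM2r// FM// ltW.
have e := differentiation_under_integral mI aI h1 h2 h3 h4 h5.
have d' := derivable_under_integral mI aI h1 h2 h3 h4 h5.
have := derivable_is_derive d'; rewrite e.
rewrite (_ : Rintegral _ _ _ = intop Fx f a)//.
by apply: eq_Rintegral => y _; rewrite /partial1of2 (is_derive_derive1 (d a y)).
Qed.

Lemma ae_imply (P Q : R -> Prop) : (forall y, P y -> Q y) ->
  {ae mu, forall y, P y} -> {ae mu, forall y, Q y}.
Proof. by move=> PQ; apply: negligibleS => y /=; apply: contra_not; exact: PQ. Qed.

Lemma ae_imply2 (P Q S : R -> Prop) : (forall y, P y -> Q y -> S y) ->
  {ae mu, forall y, P y} -> {ae mu, forall y, Q y} -> {ae mu, forall y, S y}.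
Proof.
move=> PQS p q; apply: (negligibleS _ (negligibleU p q)) => y /= nS.
by apply: contrapT => /not_orP[/contrapT Py /contrapT Qy]; exact: nS (PQS y Py Qy).
Qed.

Lemma intop_ae_eq (F : R -> R -> R) f g x : continuous (F x) ->
  measurable_fun I f -> measurable_fun I g ->
  {ae mu, forall y, I y -> f y = g y} -> intop F f x = intop F g x.
Proof.
move=> cF mf mg fg; congr fine; apply: ae_eq_integral => //.
- by apply/measurable_EFinP; apply: measurable_funM => //; exact: continuous_measurable.
- by apply/measurable_EFinP; apply: measurable_funM => //; exact: continuous_measurable.
- by apply: ae_imply fg => y h Iy; rewrite h.
Qed.

(** The boundary terms at [0] and [2 * pi] cancel by the two periodicity hypotheses. *)
Lemma intop_by_parts (F Fy : R -> R -> R) (h dh : R -> R) x :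
  (forall y, is_derive y 1 (F x) (Fy x y)) -> continuous (Fy x) ->
  (forall y, is_derive y 1 h (dh y)) -> continuous dh ->
  F x (2 * pi) = F x 0 -> h (2 * pi) = h 0 ->
  intop Fy h x = - intop F dh x.
Proof.
move=> dF cFy dh' cdh FE hE.
have pi0 : 0 < 2 * pi :> R by rewrite mulr_gt0 ?pi_gt0.
have LR (u du : R -> R) : (forall y, is_derive y 1 u (du y)) ->
    derivable_oo_LRcontinuous u 0 (2 * pi).
  move=> d; split.
  - by move=> y _; exact: ex_derive.
  - by apply: cvg_at_right_filter; exact: is_derive_continuous (d 0).
  - by apply: cvg_at_left_filter; exact: is_derive_continuous (d (2 * pi)).
have := @Rintegration_by_parts R h (F x) dh (Fy x) 0 (2 * pi) pi0.
move=> /(_ _ (LR _ _ dh') _ _ (LR _ _ dF) _).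
rewrite FE hE subrr sub0r => e.
rewrite /intop; under eq_Rintegral do rewrite mulrC.
rewrite e.
- by congr (- _); apply: eq_Rintegral => y _; rewrite mulrC.
- exact: continuous_subspaceT.
- by move=> y _; exact: is_derive_derive1.
- exact: continuous_subspaceT.
- by move=> y _; exact: is_derive_derive1.
Qed.

End IntegralOperators.

(** * Integral operators commuting with [d^2/dx^2 + q] *)

Section CommutingKernel.
Variable R : realType.
Notation mu := (@lebesgue_measure R).
Notation I := (@I02 R).
Implicit Types (f g h : R -> R) (x y : R) (F G : R -> R -> R).

Lemma intopD F f g x : continuous (F x) -> mu.-integrable I (EFin \o f) ->
  mu.-integrable I (EFin \o g) ->
  intop F (fun y => f y + g y) x = intop F f x + intop F g x.
Proof.
move=> cF fi gi; rewrite -RintegralD; last 3 first.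
- exact: measurable_I02.
- exact: integrable_continuousM.
- exact: integrable_continuousM.
by apply: eq_Rintegral => y _; rewrite mulrDr.
Qed.

Lemma intopZ F f (c : R) x : continuous (F x) -> mu.-integrable I (EFin \o f) ->
  intop F (fun y => c * f y) x = c * intop F f x.
Proof.
move=> cF fi; rewrite -RintegralZl; last 2 first.
- exact: measurable_I02.
- exact: integrable_continuousM.
by apply: eq_Rintegral => y _; rewrite mulrCA.
Qed.

Lemma intop_kernelB F G f x : continuous (F x) -> continuous (G x) ->
  mu.-integrable I (EFin \o f) ->
  intop (fun x y => F x y - G x y) f x = intop F f x - intop G f x.
Proof.
move=> cF cG fi; rewrite -RintegralB; last 3 first.
- exact: measurable_I02.
- exact: integrable_continuousM.
- exact: integrable_continuousM.
by apply: eq_Rintegral => y _; rewrite mulrBl.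
Qed.

Lemma periodic_derivative f (df : R -> R) : (forall x, is_derive x 1 f (df x)) ->
  periodic2pi f -> periodic2pi df.
Proof.
move=> d p x; have d1 : is_derive x 1 (fun x => f (x + 2 * pi)) (df (x + 2 * pi)).
  by derive; ring.
rewrite -(is_derive_derive1 d1) -(is_derive_derive1 (d x)).
by congr (derive1 _ x); apply/funext => t; exact: p.
Qed.

Variables (W K Kx Ky : R -> R -> R) (q : R -> R).
Hypothesis C1W : C1_2 W.
Hypothesis perW : forall x y, W (x + 2 * pi) y = W x y /\ W x (y + 2 * pi) = W x y.
Hypothesis dKx : forall x y, is_derive x 1 (K ^~ y) (Kx x y).
Hypothesis dKy : forall x y, is_derive y 1 (K x) (Ky x y).
Hypothesis cK : continuous (fun z : R * R => K z.1 z.2).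
Hypothesis cKx : continuous (fun z : R * R => Kx z.1 z.2).
Hypothesis cKy : continuous (fun z : R * R => Ky z.1 z.2).
Hypothesis perK : forall x y, K x (y + 2 * pi) = K x y.
Hypothesis transport : forall x y, derive1 (W ^~ y) x + derive1 (W x) y = K x y.
Hypothesis cq : continuous q.
Hypothesis curl : forall x y, Kx x y - Ky x y = (q y - q x) * W x y.

Let Wx x y : R := derive1 (W ^~ y) x.
Let Wy x y : R := derive1 (W x) y.
Let dWx x y : is_derive x 1 (W ^~ y) (Wx x y).
Proof. exact: derivable_is_derive (C1W.1 x y).1. Qed.
Let dWy x y : is_derive y 1 (W x) (Wy x y).
Proof. exact: derivable_is_derive (C1W.1 x y).2. Qed.
Let cW : continuous (fun z : R * R => W z.1 z.2). Proof. exact: C1W.2.1. Qed.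
Let cWx : continuous (fun z : R * R => Wx z.1 z.2). Proof. exact: C1W.2.2.1. Qed.
Let cWy : continuous (fun z : R * R => Wy z.1 z.2). Proof. exact: C1W.2.2.2. Qed.

(** Replaces [W_x] by [K - W_y] and integrates the second term by parts, which moves the derivative
    onto [h]. *)
Lemma intop_transport h (dh : R -> R) x : (forall y, is_derive y 1 h (dh y)) ->
  continuous dh -> periodic2pi h -> intop Wx h x = intop K h x + intop W dh x.
Proof.
move=> dhE cdh ph.
have ch : continuous h by move=> y; exact: is_derive_continuous (dhE y).
have -> : intop Wx h x = intop (fun x y => K x y - Wy x y) h x.
  by apply: eq_Rintegral => y _; rewrite -transport addrK.
rewrite intop_kernelB.
- rewrite (intop_by_parts (dWy x) _ dhE cdh) ?opprK//.
  + exact: continuous_slice.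
  + by rewrite -[2 * pi]add0r (perW x 0).2.
  + by rewrite -[2 * pi]add0r ph.
- exact: continuous_slice.
- exact: continuous_slice.
- exact: continuous_integrable_I02.
Qed.

(** The kernel is only C^1, so the second derivative of [g] comes from differentiating [K g + T g']
    instead of differentiating [W] twice. *)
Lemma commuting_kernel_eigenfunction (nu : R) f : nu != 0 -> simple_eigenvalue W nu ->
  eigenfun W nu f ->
  exists (g dg ddg : R -> R) (c : R), [/\ {ae mu, forall x, I x -> g x = f x}, periodic2pi g,
    (forall x : R, is_derive x 1 g (dg x)) /\ (forall x : R, is_derive x 1 dg (ddg x)),
    continuous ddg & forall x, ddg x + q x * g x = c * g x].
Proof.
move=> nu0 [_ simple] eigf; have [sf [fn0 fE]] := eigf.
have fi := sq_int_integrable sf.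
(* An eigenfunction is only determined almost everywhere; [g] is the representative given by the
   eigenvalue equation itself, continuous and periodic like the kernel. *)
pose g x := nu^-1 * intop W f x.
have gf : {ae mu, forall x, I x -> g x = f x}.
  by apply: ae_imply fE => x h Ix; rewrite /g h// mulKf.
have cg : continuous g.
  by move=> x; apply: cvgM; [exact: cvg_cst|exact: (intop_continuous cW fi)].
have gi := continuous_integrable_I02 cg.
have mg := (continuous_sq_int cg).1.
have nug x : nu * g x = intop W g x.
  have -> : nu * g x = intop W f x by rewrite /g mulVKf.
  apply: intop_ae_eq => //; first exact: continuous_slice.
  - exact: sf.1.
  - by apply: ae_imply gf => y h Iy; rewrite h.
have gE x : g x = nu^-1 * intop W g x by rewrite -nug mulKf.
have pg : periodic2pi g.
  by move=> x; rewrite /g; congr (_ * _); apply: eq_Rintegral => y _; rewrite (perW x y).1.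
have dscale F G h x : is_derive x 1 (intop F h) (intop G h x) ->
    is_derive x 1 (fun x => nu^-1 * intop F h x) (nu^-1 * intop G h x).
  by move=> d; have := is_derive_fM (is_derive_fcst nu^-1 x) d; rewrite mul0r add0r.
pose dg x := nu^-1 * intop Wx g x.
have dgE x : is_derive x 1 g (dg x).
  have e t : nu^-1 * intop W g t = g t by rewrite -gE.
  exact: (is_derive_ext e (dscale _ _ _ _ (intop_is_derive dWx cW cWx gi x))).
have cdg : continuous dg.
  by move=> x; apply: cvgM; [exact: cvg_cst|exact: (intop_continuous cWx gi)].
have dgi := continuous_integrable_I02 cdg.
have pdg := periodic_derivative dgE pg.
(* The derivative of the kernel has disappeared from the right side, which can therefore be
   differentiated once more. *)
have nudg x : nu * dg x = intop K g x + intop W dg x.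
  by rewrite -(intop_transport _ dgE)// /dg mulVKf.
pose ddg x := nu^-1 * (intop Kx g x + intop Wx dg x).
have ddgE x : is_derive x 1 dg (ddg x).
  have e t : nu^-1 * (intop K g t + intop W dg t) = dg t by rewrite -nudg mulKf.
  have d := is_derive_fD (intop_is_derive dKx cK cKx gi x) (intop_is_derive dWx cW cWx dgi x).
  have := is_derive_fM (is_derive_fcst nu^-1 x) d; rewrite mul0r add0r.
  exact: (is_derive_ext e).
have cddg : continuous ddg.
  move=> x; apply: cvgM; first exact: cvg_cst.
  apply: cvgD; first exact: (intop_continuous cKx gi).
  exact: (intop_continuous cWx dgi).
have ddgi := continuous_integrable_I02 cddg.
(* Differentiating gives [Kx g + Wx g']. Transport turns the last term into [K g' + T g''], and
   [K g' = - Ky g] by parts. *)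
have nuddg x : nu * ddg x = intop Kx g x - intop Ky g x + intop W ddg x.
  have -> : nu * ddg x = intop Kx g x + intop Wx dg x by rewrite /ddg mulVKf.
  rewrite (intop_transport _ ddgE)//.
  have := @intop_by_parts _ K Ky g dg x (dKy x) (@continuous_slice _ Ky x cKy) dgE cdg.
  by rewrite -[2 * pi]add0r perK pg => -> //; rewrite opprK addrA.
have cqg : continuous (fun y => q y * g y).
  by move=> x; apply: cvgM; [exact: cq|exact: cg].
have qgi := continuous_integrable_I02 cqg.
pose Lg x := ddg x + q x * g x.
have cLg : continuous Lg by move=> x; apply: cvgD; [exact: cddg|exact: cqg].
(* By [curl], the term [(Kx - Ky) g] equals [T (q g) - q T g], and [T g = nu g]. *)
have TL x : intop W Lg x = nu * Lg x.
  have cWs := @continuous_slice _ W x cW.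
  rewrite intopD//.
  have : intop Kx g x - intop Ky g x = intop W (fun y => q y * g y) x - q x * intop W g x.
    rewrite -intop_kernelB//; try exact: continuous_slice.
    rewrite -mulNr -intopZ// -intopD//; last first.
      apply: continuous_integrable_I02 => y.
      by apply: cvgM; [exact: cvg_cst|exact: cg].
    by apply: eq_Rintegral => y _; rewrite curl; ring.
  by move=> e; rewrite /Lg mulrDr nuddg e -nug [nu * (_ * _)]mulrCA addrAC subrK addrC.
have eigg : eigenfun W nu g.
  split; first exact: continuous_sq_int.
  split.
    move=> gz; apply: fn0.
    by apply: ae_imply2 gz gf => x h1 h2 Ix; rewrite -h2// h1.
  by apply: aeW => x _; rewrite nug.
have [c cE] : exists c, {ae mu, forall x, I x -> Lg x = c * g x}.
  (* Eigenfunctions are nonzero by definition, so a vanishing [Lg] is treated apart, with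
     [c = 0]. *)
  have [z|nz] := pselect {ae mu, forall x, I x -> Lg x = 0}.
    by exists 0; apply: ae_imply z => x h Ix; rewrite h// mul0r.
  apply: (simple g Lg eigg); split; first exact: continuous_sq_int.
  by split => //; apply: aeW => x _; rewrite TL.
exists g, dg, ddg, c; split => // x.
(* Applying [T] to both sides turns the almost-everywhere relation into an identity at every
   point. *)
apply: (mulfI nu0); rewrite -/(Lg x) -TL mulrCA nug -intopZ//; last exact: continuous_slice.
apply: intop_ae_eq => //; first exact: continuous_slice.
- exact: (continuous_sq_int cLg).1.
- apply: (continuous_sq_int (f := fun y => c * g y) _).1 => y.
  by apply: cvgM; [exact: cvg_cst|exact: cg].
Qed.

End CommutingKernel.

(** * Hilbert-Schmidt property and self-adjointness *)

Section SymmetricKernel.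
Variable R : realType.
Notation mu := (@lebesgue_measure R).
Notation I := (@I02 R).
Notation TR := (measurableTypeR R).
Implicit Types (f g : R -> R) (x y : R).

Variable W : R -> R -> R.
Hypothesis cW : continuous (fun z : R * R => W z.1 z.2).
Hypothesis mW : @measurable_fun _ _ (TR * TR)%type R setT (fun z : R * R => W z.1 z.2).
Hypothesis symW : forall x y, W x y = W y x.

(** The kernel is bounded on a square of finite measure, and its operator maps into continuous
    functions. *)
Lemma continuous_hilbert_schmidt : hilbert_schmidt_kernel W.
Proof.
have mII : @measurable _ (TR * TR)%type (I `*` I).
  by apply: measurableX; exact: measurable_I02.
have mWI : @measurable_fun _ _ (TR * TR)%type R (I `*` I) (fun z : R * R => W z.1 z.2).
  exact: measurable_funS mW.
split; first exact: mWI.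
split; last first.
  move=> f sf; apply: continuous_sq_int; apply: intop_continuous => //.
  exact: sq_int_integrable.
have [M M0 WM] := rectangle_bound 0 (2 * pi) cW.
apply: (@measurable_bounded_integrable _ (TR * TR)%type R (mu \x mu)%E
  (fun z : R * R => W z.1 z.2 ^+ 2) (I `*` I) mII).
- rewrite /= product_measure1E//; try exact: measurable_I02.
  by rewrite lte_mul_pinfty// ?mu_I02_lty// ge0_fin_numE// mu_I02_lty.
- exact: measurable_funX.
- exists (M ^+ 2); split; first exact: num_real.
  move=> N MN -[x y] [Ix Iy] /=; apply: le_trans (ltW MN).
  rewrite normrX lerXn2r ?nnegrE//; move: Ix; rewrite /I02 /= in_itv /= => /andP[h1 h2].
  exact: WM.
Qed.

(** Evaluates the inner integral of the Fubini argument, where [c] stands for the factor depending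
    on the outer variable. *)
Lemma integral_restrict_scale (F : R -> R) f (c : R) : continuous F ->
  mu.-integrable I (EFin \o f) ->
  (\int[mu]_y (F y * (f \_ I) y * c)%:E = (Rintegral mu I (fun y => F y * f y) * c)%:E)%E.
Proof.
move=> cF fi; have Ffi := integrable_continuousM cF fi.
transitivity (\int[mu]_(y in I) (F y * f y * c)%:E)%E.
  rewrite [RHS]integral_mkcond; apply: eq_integral => y _.
  by rewrite !patchE; case: ifP => // _; rewrite mulr0 mul0r.
under eq_integral do rewrite EFinM.
rewrite integralZr; [|exact: measurable_I02|exact: Ffi].
rewrite EFinM /Rintegral fineK//.
by apply: integrable_fin_num; [exact: measurable_I02|exact: Ffi].
Qed.

(** Fubini for [W x y * f y * g x], followed by the symmetry of [W]. *)
Lemma symmetric_self_adjoint : self_adjoint_kernel W.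
Proof.
move=> f g sf sg.
have mI := @measurable_I02 R.
have fi := sq_int_integrable sf; have gi := sq_int_integrable sg.
(* Extension by zero lets Fubini run over the whole plane. *)
pose f' : TR -> R := f \_ I; pose g' : TR -> R := g \_ I.
have mf' : measurable_fun setT f' by apply/(measurable_restrictT _ _).1 => //; exact: sf.1.
have mg' : measurable_fun setT g' by apply/(measurable_restrictT _ _).1 => //; exact: sg.1.
have f'i : mu.-integrable setT (EFin \o f').
  by have := (integrable_mkcond _ mI).1 fi; rewrite restrict_EFin.
have g'i : mu.-integrable setT (EFin \o g').
  by have := (integrable_mkcond _ mI).1 gi; rewrite restrict_EFin.
pose Phi (z : TR * TR) : \bar R := (W z.1 z.2 * f' z.2 * g' z.1)%:E.
have mPhi : measurable_fun setT Phi.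
  apply/measurable_EFinP; apply: measurable_funM; first apply: measurable_funM.
  - exact: mW.
  - exact: (measurableT_comp mf' measurable_snd).
  - exact: (measurableT_comp mg' measurable_fst).
have [M M0 WM] := rectangle_bound 0 (2 * pi) cW.
have PhiM x y : `|W x y * f' y * g' x| <= M * `|g' x| * `|f' y|.
  rewrite !normrM mulrAC.
  have [Ix|Ix] := pselect (I x); last first.
    by rewrite /g' patchE memNset// normr0 !mulr0 !mul0r.
  have [Iy|Iy] := pselect (I y); last first.
    by rewrite /f' patchE memNset// normr0 !mulr0.
  rewrite ler_wpM2r// ler_wpM2r//.
  by move: Ix; rewrite /I02 /= in_itv /= => /andP[h1 h2]; exact: WM.
have iPhi : (mu \x mu)%E.-integrable setT Phi.
  apply/(@integrable12ltyP _ _ TR TR R mu mu Phi mPhi).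
  (* By Tonelli it is enough that the inner integral of [|Phi|] is at most [N * M * |g' x|], which
     is integrable in [x]. *)
  pose N := (\int[mu]_y `|f' y|%:E)%E.
  have Nfin : N \is a fin_num.
    by apply: integrable_fin_num => //; exact: (integrable_norm f'i).
  have N0 : (0 <= N)%E by apply: integral_ge0 => y _; rewrite lee_fin.
  have gN := integrableZl measurableT (fine N * M) (integrable_norm g'i).
  apply: le_lt_trans (integrable_lty measurableT gN).
  apply: ge0_le_integral => //.
  - by move=> x _; apply: integral_ge0.
  - apply: (@measurable_fun_fubini_tonelli_F _ _ TR TR R mu (abse \o Phi)) => //=.
    exact: measurableT_comp.
  - exact: (measurable_int mu gN).
  move=> x _; rewrite EFinM -muleA [X in (_ <= X)%E]muleC fineK// -EFinM.
  have Mg0 : 0 <= M * `|g' x| by rewrite mulr_ge0.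
  rewrite -ge0_integralZl_EFin//; last first.
    by apply/measurable_EFinP; exact: measurableT_comp.
  apply: ge0_le_integral => //.
  - apply: measurableT_comp => //.
    exact: (measurableT_comp mPhi (measurable_pair1 x)).
  - by apply: measurable_funeM; apply/measurable_EFinP; exact: measurableT_comp.
  - by move=> y _ /=; rewrite -EFinM lee_fin PhiM.
have F := Fubini iPhi.
transitivity (\int[mu]_x \int[mu]_y Phi (x, y))%E.
  rewrite integral_mkcond; apply: eq_integral => x _ /=.
  rewrite patchE /Phi /=; case: ifPn => xI.
    rewrite integral_restrict_scale//; last exact: continuous_slice.
    by rewrite /g' patchE xI.
  under eq_integral do rewrite /g' patchE (negbTE xI) mulr0.
  by rewrite integral0.
rewrite F; rewrite [RHS]integral_mkcond; apply: eq_integral => y _ /=.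
rewrite patchE /Phi /=; case: ifPn => yI; last first.
  under eq_integral do rewrite /f' patchE (negbTE yI) mulr0 mul0r.
  by rewrite integral0.
under eq_integral do rewrite mulrAC symW.
rewrite integral_restrict_scale//; last exact: continuous_slice.
by rewrite /f' patchE yI mulrC.
Qed.

End SymmetricKernel.

(** * The Mathieu kernel as a commuting kernel *)

Section MathieuKernelOperator.
Variable R : realType.
Notation mu := (@lebesgue_measure R).
Notation TR := (measurableTypeR R).
Implicit Types x y : R.
Variables (alpha lam : R) (A dA : R -> R).
Hypothesis solA : hill_sol (mathieu_pot alpha lam) A dA.
Hypothesis perA : periodic2pi A.
Hypothesis nzA : exists x, A x != 0.

Notation W := (mathieu_kernel alpha lam A dA).
Notation d2A := (mathieu_d2 alpha lam A).

Let dAE x : is_derive x 1 A (dA x). Proof. exact: solA.1. Qed.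
Let ddAE x : is_derive x 1 dA (d2A x). Proof. exact: solA.2. Qed.
Let cA : continuous A. Proof. by move=> x; exact: is_derive_continuous (dAE x). Qed.
Let cdA : continuous dA. Proof. by move=> x; exact: is_derive_continuous (ddAE x). Qed.
Let cddA : continuous d2A.
Proof. by move=> x; apply: cvgN; apply: cvgM; [exact: continuous_mathieu_pot|exact: cA]. Qed.

(** Inversion is continuous on the open complement of [0], and any function is measurable on a
    single point. *)
Lemma measurable_invr : measurable_fun setT (fun t : R => t^-1).
Proof.
have -> : [set: R] = [set 0] `|` ~` [set 0] by rewrite setUv.
apply/measurable_funU => //; first exact: measurableC.
split; first exact: measurable_fun_set1.
apply: open_continuous_measurable_fun.
  by rewrite openC; exact: closed_eq.
by move=> t /set_mem /eqP t0; exact: inv_continuous.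
Qed.

(** Measurability refers to the product sigma-algebra, so the kernel is assembled from measurable
    functions of [x], of [y] and of [x - y]. *)
Lemma mathieu_kernel_measurable :
  @measurable_fun _ _ (TR * TR)%type R setT (fun z : R * R => W z.1 z.2).
Proof.
have m1 (u : R -> R) : continuous u ->
    @measurable_fun _ _ (TR * TR)%type R setT (fun z : R * R => u z.1).
  by move=> cu; exact: (measurableT_comp (continuous_measurable_fun cu) measurable_fst).
have m2 (u : R -> R) : continuous u ->
    @measurable_fun _ _ (TR * TR)%type R setT (fun z : R * R => u z.2).
  by move=> cu; exact: (measurableT_comp (continuous_measurable_fun cu) measurable_snd).
have cid : continuous (fun t : R => t) by move=> t; exact: cvg_id.
have ms : @measurable_fun _ _ (TR * TR)%type R setT (fun z : R * R => z.1 - z.2).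
  exact: (measurable_funB (m1 _ cid) (m2 _ cid)).
have m3 (u : R -> R) : continuous u ->
    @measurable_fun _ _ (TR * TR)%type R setT (fun z : R * R => u (z.1 - z.2)).
  by move=> cu; exact: (measurableT_comp (continuous_measurable_fun cu) ms).
have mV (u : R * R -> R) : @measurable_fun _ _ (TR * TR)%type R setT u ->
    @measurable_fun _ _ (TR * TR)%type R setT (fun z : R * R => (u z)^-1).
  by move=> mu'; exact: (measurableT_comp measurable_invr mu').
rewrite /mathieu_kernel; apply: measurable_fun_ifT.
- apply: measurable_fun_eqr => //; apply: m3; exact: continuous_sin.
- apply: measurable_funM; last by apply: mV; apply: m3; exact: continuous_cos.
  by apply: measurable_funB; apply: measurable_funM; [exact: m1|exact: m2|exact: m1|exact: m2].
- apply: measurable_funM; last by apply: mV; apply: m3; exact: continuous_sin.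
  by apply: measurable_funB; apply: measurable_funM; [exact: m1|exact: m2|exact: m1|exact: m2].
Qed.

Let K x y : R := - 2 * alpha * sin (x + y) * (A x * A y).
Let Kx x y : R := - 2 * alpha * (cos (x + y) * (A x * A y) + sin (x + y) * (dA x * A y)).
Let Ky x y : R := - 2 * alpha * (cos (x + y) * (A x * A y) + sin (x + y) * (A x * dA y)).

Let c1 (u : R -> R) : continuous u -> continuous (fun z : R * R => u z.1).
Proof.
move=> cu z; have h : w.1 @[w --> z] --> z.1 by exact: cvg_fst.
exact: (cvg_comp _ _ h (cu z.1)).
Qed.
Let c2 (u : R -> R) : continuous u -> continuous (fun z : R * R => u z.2).
Proof.
move=> cu z; have h : w.2 @[w --> z] --> z.2 by exact: cvg_snd.
exact: (cvg_comp _ _ h (cu z.2)).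
Qed.
Let c3 (u : R -> R) : continuous u -> continuous (fun z : R * R => u (z.1 + z.2)).
Proof.
move=> cu z; have h : w.1 + w.2 @[w --> z] --> z.1 + z.2.
  by apply: cvgD; [exact: cvg_fst|exact: cvg_snd].
exact: (cvg_comp _ _ h (cu (z.1 + z.2))).
Qed.
Let cM (u v : R * R -> R) : continuous u -> continuous v -> continuous (fun z => u z * v z).
Proof. by move=> cu cv z; apply: cvgM; [exact: cu|exact: cv]. Qed.
Let cZ (c : R) (v : R * R -> R) : continuous v -> continuous (fun z => c * v z).
Proof. by move=> cv z; apply: cvgM; [exact: cvg_cst|exact: cv]. Qed.
Let cD (u v : R * R -> R) : continuous u -> continuous v -> continuous (fun z => u z + v z).
Proof. by move=> cu cv z; apply: cvgD; [exact: cu|exact: cv]. Qed.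

(** Here [q = alpha cos 2x]. The hypothesis [curl] holds since [Kx - Ky] is [2 alpha sin (x + y)]
    times the numerator of [W], that is, times [sin (x - y) * W x y]. *)
Lemma mathieu_kernel_eigenfunction (nu : R) f : nu != 0 -> simple_eigenvalue W nu ->
  eigenfun W nu f ->
  exists (g dg ddg : R -> R) (c : R), [/\ {ae mu, forall x, I02 x -> g x = f x},
    periodic2pi g,
    (forall x : R, is_derive x 1 g (dg x)) /\ (forall x : R, is_derive x 1 dg (ddg x)),
    continuous ddg & forall x, ddg x + alpha * cos (2 * x) * g x = c * g x].
Proof.
apply: (@commuting_kernel_eigenfunction _ W K Kx Ky (fun x => alpha * cos (2 * x))).
- exact: (mathieu_kernel_C1 solA).
- move=> x y; split; first exact: mathieu_kernel_periodic.
  by rewrite [LHS]mathieu_kernelC mathieu_kernel_periodic// [RHS]mathieu_kernelC.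
- by move=> x y; rewrite /K /Kx; derive; ring.
- by move=> x y; rewrite /K /Ky; derive; ring.
- apply: (@cM (fun z => - 2 * alpha * sin (z.1 + z.2)) (fun z => A z.1 * A z.2)).
    by apply: cZ; apply: c3; exact: continuous_sin.
  by apply: cM; [exact: c1|exact: c2].
- apply: cZ; apply: cD; apply: cM.
  + by apply: c3; exact: continuous_cos.
  + by apply: cM; [exact: c1|exact: c2].
  + by apply: c3; exact: continuous_sin.
  + by apply: cM; [exact: c1|exact: c2].
- apply: cZ; apply: cD; apply: cM.
  + by apply: c3; exact: continuous_cos.
  + by apply: cM; [exact: c1|exact: c2].
  + by apply: c3; exact: continuous_sin.
  + by apply: cM; [exact: c1|exact: c2].
- by move=> x y; rewrite /K perA addrA [2 * pi]mulr_natl sinD2pi.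
- by move=> x y; exact: mathieu_kernel_transport.
- move=> x; apply: cvgM; first exact: cvg_cst.
  apply: continuous_cvg; first exact: continuous_cos.
  by apply: cvgM; [exact: cvg_cst|exact: cvg_id].
- move=> x y.
  have -> : Kx x y - Ky x y = - 2 * alpha * sin (x + y) * (dA x * A y - A x * dA y).
    by rewrite /Kx /Ky; ring.
  have cxy : cos (2 * y) - cos (2 * x) = 2 * sin (x + y) * sin (x - y).
    have -> : 2 * x = (x + y) + (x - y) by ring.
    have -> : 2 * y = (x + y) - (x - y) by ring.
    by move: (x + y) (x - y) => u v; rewrite cosB cosD; ring.
  rewrite -mulrBr cxy.
  have -> : alpha * (2 * sin (x + y) * sin (x - y)) * W x y =
      2 * alpha * sin (x + y) * (sin (x - y) * W x y) by ring.
  suff -> : sin (x - y) * W x y = A x * dA y - dA x * A y by ring.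
  by exact: sin_mathieu_kernel.
Qed.

End MathieuKernelOperator.

Unset Implicit Arguments.

Theorem theorem6p1 (R : realType) (alpha : R) :
  infinite_set [set lam : R | exists y : R -> R,
      mathieu_sol alpha lam y /\ periodic2pi y /\ exists x, y x != 0] /\
  (forall (lam : R) (A : R -> R),
     mathieu_sol alpha lam A -> periodic2pi A -> (exists x, A x != 0) ->
     exists W : R -> R -> R,
       C1_2 W /\
       (forall x y, W (x + 2 * pi) y = W x y /\ W x (y + 2 * pi) = W x y) /\
       (forall x y, sin (x - y) != 0 ->
          W x y = (A x * derive1 A y - derive1 A x * A y) / sin (x - y)) /\
       (* (i) *)
       (hilbert_schmidt_kernel W /\ self_adjoint_kernel W) /\
       (* (ii) *)
       (forall nu : R, nu != 0 -> simple_eigenvalue W nu ->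
          forall f : R -> R, eigenfun W nu f ->
            exists g : R -> R,
              {ae lebesgue_measure, forall x, I02 x -> g x = f x} /\
              periodic2pi g /\ C2 g /\
              exists mu : R, forall x,
                derive1 (derive1 g) x + (mu + alpha * cos (2 * x)) * g x = 0)).
Proof.
split; first exact: mathieu_periodic_infinite.
move=> lam A /mathieu_sol_hill solA perA nzA.
exists (mathieu_kernel alpha lam A (derive1 A)).
have C1W := mathieu_kernel_C1 solA perA nzA.
have cW := C1W.2.1.
have mW : @measurable_fun _ _ (measurableTypeR R * measurableTypeR R)%type R setT
    (fun z : R * R => mathieu_kernel alpha lam A (derive1 A) z.1 z.2).
  exact: (mathieu_kernel_measurable solA).
have symW := @mathieu_kernelC R alpha lam A (derive1 A).
split; first exact: C1W.
split.
  move=> x y; split; first exact: (mathieu_kernel_periodic solA).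
  by rewrite [LHS]symW (mathieu_kernel_periodic solA)// symW.
split; first by move=> x y; exact: mathieu_kernelE.
split.
  split; first exact (@continuous_hilbert_schmidt R (mathieu_kernel alpha lam A (derive1 A)) cW mW).
  exact (@symmetric_self_adjoint R (mathieu_kernel alpha lam A (derive1 A)) cW mW symW).
move=> nu nu0 simple f eigf.
have [g [dg [ddg [c [gf pg [dgE ddgE] cddg gE]]]]] :=
  mathieu_kernel_eigenfunction solA perA nzA nu0 simple eigf.
have e1 : derive1 g = dg by apply/funext => x; exact: is_derive_derive1.
have e2 : derive1 dg = ddg by apply/funext => x; exact: is_derive_derive1.
exists g; split => //; split => //; split.
  rewrite /C2 e1 e2; split; first by move=> x; exact: (@ex_derive _ _ _ _ _ _ _ (dgE x)).
  by split => // x; exact: (@ex_derive _ _ _ _ _ _ _ (ddgE x)).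
(* The eigenvalue [c] of [d^2/dx^2 + alpha cos 2x] enters Mathieu's equation with the opposite
   sign. *)
exists (- c) => x; rewrite e1 e2; have := gE x; lra.
Qed.
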